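(* Let $X\subseteq\mathbb{P}^r$ be a quasi-projective variety of dimension $n\ge 1$ and let $k\ge 2$. On the open set $\mathbf{U}_{k-1}$ of $X$, consider the differential $$dg_{k-1}:T_X\longrightarrow g_{k-1}^*T_{\mathbb{G}}=\mathscr{H}om(P_{k-1}^*\otimes L^*,\,R^*_{k-1}\otimes L^* )$$ of the $(k-1)$-th Gauss map $g_{k-1}$. (1) The $k$-th fundamental form $\mathbf{F}^*_k:R_{k-1}\to S^k\Omega^1_X$ is determined by the differential $dg_{k-1}$ and vice versa. (2) On a nonsingular affine open subset contained in $\mathbf{U}_{k-1}$ on which there are functions $s_1,\dots,s_n$ with $ds_1,\dots,ds_n$ a basis of $\Omega^1_X$, for a vector field $\partial\in T_X$ the induced map $\mathbf{F}_{k,\partial}\otimes L^*:S^{k-1}T_X\otimes L^*\to R^*_{k-1}\otimes L^*$ fits into a commutative square, i.e. $$dg_{k-1}(\partial)\circ\alpha^*_{k-1}=(\mathbf{F}_{k,\partial}\otimes L^* )\circ pr_{k-1}$$ as maps $P^{k-1}(L)^*\to R^*_{k-1}\otimes L^*$, where $\alpha_{k-1}^*:P^{k-1}(L)^*\to P^*_{k-1}\otimes L^*$ and $pr_{k-1}:P^{k-1}(L)^*\to S^{k-1}T_X\otimes L^*$.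
   Context: Work over $\mathbb{C}$; a variety is separated, reduced, irreducible, of finite type over $\mathbb{C}$. Let $L=\mathcal{O}_X(1)$, $V=H^0(\mathbb{P}^r,\mathcal{O}_{\mathbb{P}^r}(1))$; $\mathbb{P}^r=\mathbb{P}(V)$ is the space of one-dimensional quotients of $V$. ${}^*$ denotes the dual. For $k\ge 0$ let $P^k(L)=pr_{1,*}\big((\mathcal{O}_{X\times X}/I_\Delta^{k+1})\otimes pr_2^*L\big)$ be the sheaf of $k$-th order principal parts, where $I_\Delta$ is the ideal of the diagonal and $pr_1,pr_2$ (without further context) are the projections of $X\times X$, with universal differential operator $d^k_L:L\to P^k(L)$ induced by the second projection. The Taylor series map is $\alpha_k:V\otimes\mathcal{O}_X\to P^k(L)$, $T\otimes a\mapsto a\,d^k_L(T|_X)$. Put $R_k=(\ker\alpha_k)\otimes L^*$, $P_k=(\operatorname{Im}\alpha_k)\otimes L^*$, $\mathfrak{t}_k+1=\operatorname{rank}P_k$. Let $\mathbf{U}_k$ be the maximal open subset of $X$ contained in the nonsingular locus on which $P^i(L)/(P_i\otimes L)$ is locally free of constant rank for all $i\le k$. On the nonsingular locus the kernel of the truncation $P^k(L)\to P^{k-1}(L)$ is $S^k\Omega^1_X\otimes L$, and $\alpha_k$ restricted to $R_{k-1}\otimes L$ lands in it; twisting by $L^*$ gives the $k$-th fundamental form $\mathbf{F}^*_k:R_{k-1}\to S^k\Omega^1_X$, with dual $\mathbf{F}_k:S^kT_X\to R_{k-1}^*$ and twisted form $\mathbf{F}_k\otimes L^*$. Dualizing the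 truncation sequence gives $0\to P^{k-1}(L)^*\to P^k(L)^*\to S^kT_X\otimes L^*\to 0$; in the theorem, $pr_k$ denotes the surjection $P^k(L)^*\to S^kT_X\otimes L^*$ in this sequence. $P^k(L)^*$ is the module of differential operators $L\to\mathcal{O}_X$ of order $\le k$; for a vector field $\partial$, composition $D\mapsto\partial\circ D$ maps $P^{k-1}(L)^*\to P^k(L)^*$ and induces on quotients an $\mathcal{O}_X$-linear map $\partial:S^{k-1}T_X\otimes L^*\to S^kT_X\otimes L^*$. Define $\mathbf{F}_{k,\partial}\otimes L^*:=(\mathbf{F}_k\otimes L^* )\circ\partial$. Gauss map: the $k$-th projective tangent space is $\mathbf{T}^k_x(X)=\mathbb{P}(P_k\otimes L\otimes k(x))\subseteq\mathbb{P}^r$. The $k$-th Gauss map $g_k:\mathbf{U}_k\to\mathbb{G}(\mathbb{P}^r,\mathfrak{t}_k)$ to the Grassmannian $\mathbb{G}$ of $\mathfrak{t}_k$-dimensional linear subspaces of $\mathbb{P}^r$ sends $x$ to $\mathbf{T}^k_x(X)$; it is given by the exact sequence $0\to R_k\otimes L\to V\otimes\mathcal{O}_X\to P_k\otimes L\to 0$ on $\mathbf{U}_k$. Dually, let $\pi_k:V^*\otimes\mathcal{O}_X\to R_k^*\otimes L^*$ be the quotient with kernel $P_k^*\otimes L^*$; then for a local vector field $\partial$ and a section $B$ of $P_k^*\otimes L^*\subseteq V^*\otimes\mathcal{O}_X$, $dg_k(\partial)(B)=\pi_k(\partial B)$, where $\partial$ acts on $V^*\otimes\mathcal{O}_X$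 as $\mathrm{id}\otimes\partial$. *)

(* Defs.v *)
From HB Require Import structures.
From mathcomp Require Import all_boot all_order all_algebra all_fingroup.
From mathcomp Require Import generic_quotient ring_quotient.
From mathcomp Require Import boolp classical_sets functions reals complex.
From mathcomp Require Import mpoly ring.
Set Implicit Arguments.
Unset Strict Implicit.
Unset Printing Implicit Defensive.
Import GRing.Theory.
Local Open Scope ring_scope.
Local Open Scope classical_set_scope.
Local Open Scope complex_scope.

Record submodule (A : nzRingType) (W : lmodType A) := Submodule {
  smem :> W -> Prop;
  smem0 : smem 0;
  smemP : forall a u v, smem u -> smem v -> smem (a *: u + v) }.

Definition smemb (A : nzRingType) (W : lmodType A) (S : submodule W)
  : {pred W} := fun w => `[< S w >].

Section SubQuot.
Context {A : nzRingType} {W : lmodType A} (S : submodule W).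

Lemma smemb_closed : submod_closed (smemb S).
Proof.
split=> [|a u v /asboolP Su /asboolP Sv]; apply/asboolP; first exact: smem0.
exact: smemP.
Qed.
HB.instance Definition _ := GRing.isSubmodClosed.Build A W (smemb S) smemb_closed.

Definition sub_type := {w : W | w \in smemb S}.
HB.instance Definition _ := SubChoice.on sub_type.
HB.instance Definition _ := [SubChoice_isSubLmodule of sub_type by <:].

Definition quot_type := Quotient.quot (smemb S).
HB.instance Definition _ := Choice.on quot_type.
HB.instance Definition _ := GRing.Zmodule.on quot_type.

Definition proj : W -> quot_type := \pi_quot_type%qT.
Definition quot_scale (a : A) (x : quot_type) : quot_type := proj (a *: repr x).

Lemma proj_eq u v : S (u - v) <-> proj u = proj v.
Proof.
split=> [h|/eqP].
  by apply/eqP; rewrite /proj -Quotient.idealrBE; apply/asboolP.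
by rewrite /proj -Quotient.idealrBE => /asboolP.
Qed.

Lemma projD : {morph proj : u v / u + v}.
Proof. by move=> u v; rewrite /proj !piE. Qed.

Lemma smemZ a u : S u -> S (a *: u).
Proof. by move=> h; rewrite -[_ *: _]addr0; apply: smemP h (smem0 S). Qed.

Lemma projZ a u : quot_scale a (proj u) = proj (a *: u).
Proof.
apply/proj_eq; rewrite -scalerBr; apply: smemZ; apply/proj_eq.
exact: reprK.
Qed.

Lemma projP (x : quot_type) : exists u, x = proj u.
Proof. by exists (repr x); rewrite /proj reprK. Qed.

Lemma quot_scaleA a b x : quot_scale a (quot_scale b x) = quot_scale (a * b) x.
Proof. by have [u ->] := projP x; rewrite !projZ scalerA. Qed.
Lemma quot_scale1 : left_id 1 quot_scale.
Proof. by move=> x; have [u ->] := projP x; rewrite projZ scale1r. Qed.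
Lemma quot_scaleDr : right_distributive quot_scale +%R.
Proof.
move=> a x y; have [u ->] := projP x; have [v ->] := projP y.
by rewrite -projD !projZ -projD scalerDr.
Qed.
Lemma quot_scaleDl x : {morph quot_scale^~ x : a b / a + b}.
Proof. by move=> a b; have [u ->] := projP x; rewrite !projZ -projD scalerDl. Qed.
HB.instance Definition _ := GRing.Zmodule_isLmodule.Build A quot_type
  quot_scaleA quot_scale1 quot_scaleDr quot_scaleDl.

Definition sub_mod : lmodType A := sub_type.
Definition quot_mod : lmodType A := quot_type.
Definition sub_val (u : sub_mod) : W := val (u : sub_type).

End SubQuot.

Section Hom.
Context {A : comNzRingType}.
Implicit Types M N : lmodType A.

Definition is_linear M N (f : M -> N) :=
  forall a u v, f (a *: u + v) = a *: f u + f v.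

Lemma is_linear0 M N : is_linear (0 : M -> N).
Proof. by move=> a u v; rewrite /= scaler0 addr0. Qed.
Lemma is_linearP M N a (f g : M -> N) :
  is_linear f -> is_linear g -> is_linear (a *: f + g).
Proof.
move=> hf hg b u v.
have E w : (a *: f + g) w = a *: f w + g w by [].
rewrite !E hf hg !scalerDr !scalerA [b * a]mulrC !addrA; congr (_ + _).
by rewrite addrAC.
Qed.
Definition linear_submodule M N := Submodule (@is_linear0 M N) (@is_linearP M N).
Definition lhom M N : lmodType A := sub_mod (linear_submodule M N).

Definition hom_fun M N (f : lhom M N) : M -> N := sub_val f.
Definition mkhom M N (f : M -> N) (hf : is_linear f) : lhom M N :=
  exist (fun g => g \in smemb (linear_submodule M N)) f (asboolT hf).

Definition dual M : lmodType A := lhom M A^o.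

Lemma hom_fun_is_linear M N (f : lhom M N) : is_linear (hom_fun f).
Proof. exact: (asboolW (valP (f : sub_type (linear_submodule M N)))). Qed.

Lemma comp_is_linear M N P (g : lhom N P) (f : lhom M N) :
  is_linear (hom_fun g \o hom_fun f).
Proof. by move=> a u v; rewrite /= !hom_fun_is_linear. Qed.
Definition hcomp M N P (g : lhom N P) (f : lhom M N) : lhom M P :=
  mkhom (comp_is_linear g f).

Lemma val_is_linear M (S : submodule M) : is_linear (@sub_val _ _ S).
Proof. by []. Qed.
Definition incl M (S : submodule M) : lhom (sub_mod S) M :=
  mkhom (@val_is_linear M S).

Lemma hom_fun0 M N (f : lhom M N) : hom_fun f 0 = 0.
Proof.
by have := hom_fun_is_linear f (-1) 0 0; rewrite scaler0 addr0 scaleN1r addNr.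
Qed.

Lemma ker0 M N (f : lhom M N) : hom_fun f 0 = 0.
Proof. exact: hom_fun0. Qed.
Lemma kerP M N (f : lhom M N) a u v :
  hom_fun f u = 0 -> hom_fun f v = 0 -> hom_fun f (a *: u + v) = 0.
Proof. by move=> fu fv; rewrite hom_fun_is_linear fu fv scaler0 addr0. Qed.
Definition hker M N (f : lhom M N) := Submodule (ker0 f) (@kerP M N f).

Lemma im0 M N (f : lhom M N) : exists u, hom_fun f u = 0.
Proof. by exists 0; rewrite hom_fun0. Qed.
Lemma imP M N (f : lhom M N) a x y : (exists u, hom_fun f u = x) ->
  (exists u, hom_fun f u = y) -> exists u, hom_fun f u = a *: x + y.
Proof. by move=> [u <-] [v <-]; exists (a *: u + v); rewrite hom_fun_is_linear. Qed.
Definition him M N (f : lhom M N) := Submodule (im0 f) (@imP M N f).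

Lemma corestr_subproof M N (f : lhom M N) u : hom_fun f u \in smemb (him f).
Proof. by apply/asboolP; exists u. Qed.
Definition corestr_fun M N (f : lhom M N) (u : M) : sub_mod (him f) :=
  exist _ (hom_fun f u) (corestr_subproof f u).
Lemma corestr_is_linear M N (f : lhom M N) : is_linear (corestr_fun f).
Proof. by move=> a u v; apply: val_inj; rewrite /= hom_fun_is_linear. Qed.
Definition corestr M N (f : lhom M N) : lhom M (sub_mod (him f)) :=
  mkhom (corestr_is_linear f).

Inductive gspan M (G : M -> Prop) : M -> Prop :=
| gspan_nil : gspan G 0
| gspan_cons a u v : G u -> gspan G v -> gspan G (a *: u + v).
Lemma gspanP M (G : M -> Prop) a u v :
  gspan G u -> gspan G v -> gspan G (a *: u + v).
Proof.
move=> Gu Gv; elim: Gu => [|b g w Gg _ IH]; first by rewrite scaler0 add0r.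
by rewrite scalerDr scalerA -addrA; apply: gspan_cons.
Qed.
Definition span_mod M (G : M -> Prop) := Submodule (gspan_nil G) (@gspanP M G).

Definition is_basis M n (b : 'I_n -> M) :=
  forall m : M, exists! a : 'I_n -> A, m = \sum_i a i *: b i.
Definition free_of_rank M n := exists b : 'I_n -> M, is_basis b.

(* The free module on a type K, inside the module of all functions K -> A. *)
Definition indic (K : Type) (x : K) : K -> A^o := fun y => `[< y = x >]%:R.
Definition free_mod (K : Type) : lmodType A := sub_mod (span_mod (range (@indic K))).

Lemma fgen_subproof K (x : K) : indic x \in smemb (span_mod (range (@indic K))).
Proof.
apply/asboolP; rewrite -[indic x]addr0 -[indic x]scale1r.
by apply: gspan_cons; [exists x | apply: gspan_nil].
Qed.
Definition fgen (K : Type) (x : K) : free_mod K :=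
  exist _ (indic x) (fgen_subproof x).

Definition pres (K : Type) (G : free_mod K -> Prop) : lmodType A :=
  quot_mod (span_mod G).
Definition gen (K : Type) (G : free_mod K -> Prop) (x : K) : pres G :=
  proj (span_mod G) (fgen x).

(* The element with the property P, where P determines it; 0 if there is none. *)
Definition the_elt M (P : M -> Prop) : M := xget 0 [set m | P m].

(* The linear map with prescribed values on the generators. *)
Definition extend (K : Type) (G : free_mod K -> Prop) N (g : K -> N)
  : lhom (pres G) N := the_elt (fun f => forall x, hom_fun f (gen G x) = g x).

Inductive tens_rel M N : free_mod (M * N) -> Prop :=
| tens_l a m m' n :
    tens_rel (fgen (a *: m + m', n) - (a *: fgen (m, n) + fgen (m', n)))
| tens_r a m n n' :
    tens_rel (fgen (m, a *: n + n') - (a *: fgen (m, n) + fgen (m, n'))).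
Definition tens M N : lmodType A := pres (@tens_rel M N).
Definition tprod M N (m : M) (n : N) : tens M N := gen (@tens_rel M N) (m, n).

Definition upd k M (t : 'I_k -> M) i u : 'I_k -> M :=
  fun j => if j == i then u else t j.
Inductive sym_rel k M : free_mod ('I_k -> M) -> Prop :=
| sym_lin i a u v t : sym_rel (fgen (upd t i (a *: u + v))
    - (a *: fgen (upd t i u) + fgen (upd t i v)))
| sym_perm (s : 'S_k) (t : 'I_k -> M) :
    sym_rel (fgen (fun i => t (s i)) - fgen t).
Definition sympow k M : lmodType A := pres (@sym_rel k M).
Definition sprod k M (t : 'I_k -> M) : sympow k M := gen (@sym_rel k M) t.

End Hom.

Notation "f $$ x" := (hom_fun f x) (at level 11, left associativity).

(* A C-algebra A with structure map const, an A-module M and elements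
   T_0, ..., T_r of M: the local form of a variety, the line bundle L and the
   restrictions to X of the coordinates of P^r, a basis of V. *)
Record linsys (C : comNzRingType) (r : nat) := LinSys {
  fring : comNzRingType;
  const : {rmorphism C -> fring};
  bundle : lmodType fring;
  sect : 'I_r.+1 -> bundle }.

Section Local.
Context {C : comNzRingType} {r : nat} (E : linsys C r).
Local Notation A := (fring E).
Local Notation L := (bundle E).

Inductive kahler_rel : free_mod A -> Prop :=
| kahler_add f g : kahler_rel (fgen (f + g) - (fgen f + fgen g))
| kahler_mul f g : kahler_rel (fgen (f * g) - (f *: fgen g + g *: fgen f))
| kahler_cst c : kahler_rel (fgen (const E c)).
Definition Omega : lmodType A := pres kahler_rel.
Definition dif (f : A) : Omega := gen kahler_rel f.

Definition is_derivation (D : A -> A^o) :=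
  [/\ forall f g, D (f + g) = D f + D g,
      forall f g, D (f * g) = f * D g + g * D f
    & forall c, D (const E c) = 0].
Lemma is_derivation0 : is_derivation 0.
Proof. by split=> *; rewrite /= ?addr0 ?mulr0 ?addr0. Qed.
Lemma is_derivationP a (D D' : A -> A^o) :
  is_derivation D -> is_derivation D' -> is_derivation (a *: D + D').
Proof.
move=> [h1 h2 h3] [k1 k2 k3].
have S u : (a *: D + D') u = a * D u + D' u by [].
split=> [f g|f g|c]; rewrite !S ?h1 ?h2 ?h3 ?k1 ?k2 ?k3.
- by rewrite mulrDr addrACA.
- by rewrite !mulrDr !mulrA ![a * _]mulrC addrACA.
- by rewrite mulr0 addr0.
Qed.
Definition derivations := Submodule is_derivation0 is_derivationP.
Definition Tan : lmodType A := sub_mod derivations.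
Definition vf_fun (D : Tan) : A -> A^o := sub_val D.

Definition contr (D : Tan) : dual Omega := extend kahler_rel (vf_fun D).

(* S^k Tan and S^k Omega are dual by
   <D_1 ... D_k, w_1 ... w_k> = sum_s prod_i <D_i, w_(s i)>. This is the
   normalization for which the principal symbol of D_1 o ... o D_k is the
   product D_1 ... D_k. *)
Definition sym_pairing k : lhom (sympow k Tan) (dual (sympow k Omega)) :=
  extend (@sym_rel _ k Tan) (fun D => extend (@sym_rel _ k Omega) (fun w =>
    \sum_(s : 'S_k) \prod_i (contr (D i) $$ w (s i)) : A^o)).

(* [.. [D, f_1] .., f_j] as a function of m. For D m = 1 (x) m in A (x)_C L
   this is (1 (x) f_1 - f_1 (x) 1) ... (1 (x) f_j - f_j (x) 1) (1 (x) m). *)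
Definition iter_comm (N : lmodType A) (fs : seq A) (D : L -> N) : L -> N :=
  foldr (fun f (D : L -> N) m => D (f *: m) - f *: D m) D fs.

(* P^k(L) = (A (x)_C A / I^(k+1)) (x)_A L = (A (x)_C L) / I^(k+1) (A (x)_C L)
   with the A-module structure of the first factor. The generators are the
   1 (x) m, the first two kinds of relations define A (x)_C L, and the ideal I
   of the diagonal is generated by the 1 (x) f - f (x) 1. *)
Inductive pp_rel k : free_mod L -> Prop :=
| pp_add m m' : pp_rel k (fgen (m + m') - (fgen m + fgen m'))
| pp_scale c m : pp_rel k (fgen (const E c *: m) - const E c *: fgen m)
| pp_ideal fs m : size fs = k.+1 -> pp_rel k (iter_comm fs (@fgen A L) m).
Definition PP k : lmodType A := pres (pp_rel k).
Definition pd k (m : L) : PP k := gen (pp_rel k) m.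

(* S^k Omega (x) L -> P^k(L), onto the kernel of P^k(L) -> P^(k-1)(L):
   df_1 ... df_k (x) m |-> prod (1 (x) f_i - f_i (x) 1) (1 (x) m). *)
Definition sym_incl k : lhom (tens (sympow k Omega) L) (PP k) :=
  the_elt (fun f => forall (fs : k.-tuple A) m,
    f $$ tprod (sprod (fun i => dif (tnth fs i))) m = iter_comm fs (@pd k) m).

(* V (x) A is the module of rows of length r + 1. *)
Definition taylor_fun k (t : 'rV[A]_r.+1) : PP k :=
  \sum_i t ord0 i *: pd k (sect E i).
Lemma taylor_is_linear k : is_linear (@taylor_fun k).
Proof.
move=> a u v; rewrite /taylor_fun scaler_sumr -big_split /=.
by apply: eq_bigr => i _; rewrite !mxE scalerDl scalerA.
Qed.
Definition alpha k : lhom 'rV[A]_r.+1 (PP k) := mkhom (@taylor_is_linear k).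

Definition KerA k : lmodType A := sub_mod (hker (alpha k)).
Definition ImA k : lmodType A := sub_mod (him (alpha k)).
Definition CokerA k : lmodType A := quot_mod (him (alpha k)).

Definition Ld : lmodType A := dual L.

Definition Rk k : lmodType A := tens (KerA k) Ld.
Definition Pk k : lmodType A := tens (ImA k) Ld.

(* The canonical map (N (x) L^* )^* (x) L^* -> N^*, an isomorphism when L is
   invertible: rho (x) l |-> (n |-> rho (n (x) l)). *)
Definition untwist (N : lmodType A) : lhom (tens (dual (tens N Ld)) Ld) (dual N) :=
  the_elt (fun f => forall rho l n, f $$ tprod rho l $$ n = rho $$ tprod n l).

(* The fundamental form F^*_k : R_(k-1) -> S^k Omega; F^*_k (x) L is the
   restriction of alpha_k to R_(k-1) (x) L. *)
Definition fundform k : lhom (Rk k.-1) (sympow k Omega) :=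
  the_elt (fun F => forall (t : KerA k.-1) (l : Ld) (m : L),
    sym_incl k $$ tprod (F $$ tprod t l) m = (l $$ m : A) *: (alpha k $$ sub_val t)).

(* For G = F^*_k: the dual form F_k : S^k T -> R_(k-1)^* and F_k (x) L^*. *)
Definition fdual k (G : lhom (Rk k.-1) (sympow k Omega))
    : lhom (sympow k Tan) (dual (Rk k.-1)) :=
  the_elt (fun F => forall theta, F $$ theta = hcomp (sym_pairing k $$ theta) G).
Definition ftwist k (G : lhom (Rk k.-1) (sympow k Omega))
    : lhom (tens (sympow k Tan) Ld) (tens (dual (Rk k.-1)) Ld) :=
  extend (@tens_rel _ (sympow k Tan) Ld) (fun p => tprod (fdual G $$ p.1) p.2).

(* S^k Tan (x) L^* -> (S^k Omega (x) L)^*, and the surjection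
   pr_k : P^k(L)^* -> S^k Tan (x) L^* dual to sym_incl k. *)
Definition symdual k : lhom (tens (sympow k Tan) Ld) (dual (tens (sympow k Omega) L)) :=
  the_elt (fun f => forall theta (l : Ld) phi (m : L),
    f $$ tprod theta l $$ tprod phi m
      = ((sym_pairing k $$ theta $$ phi : A) * (l $$ m) : A^o)).
Definition pr_sym k : lhom (dual (PP k)) (tens (sympow k Tan) Ld) :=
  the_elt (fun f => forall D, symdual k $$ (f $$ D) = hcomp D (sym_incl k)).

(* Composition with the vector field d, from P^(k-1)(L)^* to P^k(L)^*, and the
   linear map which it induces on the quotients by pr_sym. *)
Definition vcomp k (d : Tan) (D : dual (PP k.-1)) : dual (PP k) :=
  the_elt (fun D' : dual (PP k) =>
    forall m : L, D' $$ pd k m = vf_fun d (D $$ pd k.-1 m)).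
Definition vsym k (d : Tan)
    : lhom (tens (sympow k.-1 Tan) Ld) (tens (sympow k Tan) Ld) :=
  the_elt (fun f => forall D, f $$ (pr_sym k.-1 $$ D) = pr_sym k $$ vcomp d D).

(* F_(k,d) (x) L^* *)
Definition ftwist_at k (G : lhom (Rk k.-1) (sympow k Omega)) (d : Tan)
    : lhom (tens (sympow k.-1 Tan) Ld) (tens (dual (Rk k.-1)) Ld) :=
  hcomp (ftwist G) (vsym k d).

(* alpha_k^* : P^k(L)^* -> P_k^* (x) L^* *)
Definition alpha_dual k : lhom (dual (PP k)) (tens (dual (Pk k)) Ld) :=
  the_elt (fun f => forall D, untwist (ImA k) $$ (f $$ D) = hcomp D (incl (him (alpha k)))).

(* V^* (x) A as the dual of V (x) A, with the action id (x) d of vector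
   fields. *)
Definition vact_fun (d : Tan) (B : dual 'rV[A]_r.+1) (t : 'rV[A]_r.+1) : A^o :=
  \sum_i t ord0 i * vf_fun d (B $$ delta_mx ord0 i).
Lemma vact_is_linear d B : is_linear (vact_fun d B).
Proof.
move=> a u v; rewrite /vact_fun scaler_sumr -big_split /=.
by apply: eq_bigr => i _; rewrite !mxE mulrDl -mulrA.
Qed.
Definition vact d B : dual 'rV[A]_r.+1 := mkhom (vact_is_linear d B).

(* P_k^* (x) L^* as a submodule of V^* (x) A, and the quotient map pi_k. *)
Definition jP k (B : tens (dual (Pk k)) Ld) : dual 'rV[A]_r.+1 :=
  hcomp (untwist (ImA k) $$ B) (corestr (alpha k)).
Definition piR k : lhom (dual 'rV[A]_r.+1) (tens (dual (Rk k)) Ld) :=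
  the_elt (fun f => forall B, untwist (KerA k) $$ (f $$ B) = hcomp B (incl (hker (alpha k)))).

(* The differential of the Gauss map g_k given by the quotient
   V (x) A -> P_k (x) L. *)
Definition dgauss k : lhom Tan (lhom (tens (dual (Pk k)) Ld) (tens (dual (Rk k)) Ld)) :=
  the_elt (fun f => forall d B, f $$ d $$ B = piR k $$ vact d (jP B)).

End Local.

(* Subsets of P^r = P(V) are subsets of V^* minus 0 = C^(r+1) minus 0 which are
   stable under scaling: a one-dimensional quotient V -> C is given, up to
   scaling, by the images of the coordinates. *)
Definition coords (R : realType) (r : nat) := 'I_r.+1 -> R[i].
HB.instance Definition _ R r := Choice.on (coords R r).
HB.instance Definition _ R r := isPointed.Build (coords R r) (fun=> 0).

Section Geometry.
Context {R : realType} {r : nat}.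
Local Notation C := R[i].
Local Notation coords := (coords R r).
Local Notation poly := {mpoly C[r.+1]}.
Implicit Types (X Y U W : set coords) (x : coords).

Definition zeros (S : set poly) : set coords := [set x | x <> (fun=> 0) /\
  forall p d, S p -> p \is d.-homog -> p.@[x] = 0].
Definition quasi_projective X := exists S S', X = zeros S `\` zeros S'.
Definition closed_in X Y := exists S, Y = X `&` zeros S.
Definition open_in X U := exists S, U = X `\` zeros S.
Definition irreducible_set Y := Y !=set0 /\ forall S S',
  Y `<=` zeros S `|` zeros S' -> Y `<=` zeros S \/ Y `<=` zeros S'.
Definition irr_chain X n (Z : 'I_n.+1 -> set coords) :=
  (forall i, closed_in X (Z i) /\ irreducible_set (Z i)) /\
  (forall i j : 'I_n.+1, (i < j)%N -> Z i `<` Z j).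
Definition has_dim X n := (exists Z, @irr_chain X n Z) /\
  forall m Z, @irr_chain X m Z -> (m <= n)%N.

(* P holds on X near x; the q <> 0 are a base of neighbourhoods. *)
Definition near_in X x (P : coords -> Prop) := exists (q : poly) d,
  [/\ q \is d.-homog, q.@[x] <> 0 & forall y, X y -> q.@[y] <> 0 -> P y].

Lemma near_inT X x P : (forall y, P y) -> near_in X x P.
Proof.
by move=> h; exists 1, 0%N; split; [exact: dhomog1|rewrite meval1; apply/eqP/oner_neq0|].
Qed.
Lemma near_inI X x P Q : near_in X x P -> near_in X x Q ->
  near_in X x (fun y => P y /\ Q y).
Proof.
move=> [p [d [hp px Pp]]] [q [e [hq qx Qq]]]; exists (p * q), (d + e)%N.
split; [exact: dhomogM|by rewrite mevalM; apply/eqP; rewrite mulf_neq0 //; apply/eqP|].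
move=> y Xy; rewrite mevalM => /eqP; rewrite mulf_eq0 negb_or.
by case/andP=> /eqP py /eqP qy; split; [exact: Pp|exact: Qq].
Qed.
Lemma near_inW X x (P Q : coords -> Prop) : (forall y, P y -> Q y) ->
  near_in X x P -> near_in X x Q.
Proof.
by move=> PQ [p [d [hp px Pp]]]; exists p, d; split=> // y Xy py; exact/PQ/Pp.
Qed.

(* Sections of O_X(d) near x are functions on the cone over X which are locally
   quotients of homogeneous polynomials with difference of degrees d. *)
Definition regular_at d X x (f : coords -> C) := exists (p q : poly) m,
  [/\ p \is (m + d).-homog, q \is m.-homog &
      near_in X x (fun y => q.@[y] <> 0 /\ f y = p.@[y] / q.@[y])].

Lemma regular_atP d X x (a f g : coords -> C) : regular_at 0 X x a ->
  regular_at d X x f -> regular_at d X x g -> regular_at d X x (a * f + g).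
Proof.
move=> [p [q [m [hp hq na]]]] [p' [q' [m' [hp' hq' nf]]]].
move=> [p'' [q'' [m'' [hp'' hq'' ng]]]].
exists (p * p' * q'' + p'' * (q * q')), (q * q' * q''), (m + m' + m'')%N; split.
- apply: dhomogD.
    have -> : (m + m' + m'' + d = m + 0 + (m' + d) + m'')%N.
      by rewrite addn0 addnA addnAC.
    by do 2?apply: dhomogM.
  have -> : (m + m' + m'' + d = m'' + d + (m + m'))%N.
    by rewrite -addnA addnC.
  by do 2?apply: dhomogM.
- by do 2?apply: dhomogM.
apply: near_inW (near_inI na (near_inI nf ng)) => y.
move=> [[/eqP q0 E1] [[/eqP q1 E2] [/eqP q2 E3]]]; split.
  by rewrite !mevalM; apply/eqP; rewrite !mulf_neq0.
have -> : (a * f + g) y = a y * f y + g y by [].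
rewrite E1 E2 E3 mevalD !mevalM; field.
by rewrite q0 q1 q2.
Qed.

Lemma regular_cst X x (c : C) : regular_at 0 X x (fun=> c).
Proof.
exists c%:MP, 1, 0%N; split; [|exact: dhomog1|].
  by rewrite -[c%:MP]mulr1 mul_mpolyC; apply: dhomogZ; exact: dhomog1.
apply: near_inT => y; rewrite meval1 mevalC divr1; split=> //.
exact/eqP/oner_neq0.
Qed.

Lemma regular_coord X x i : regular_at 1 X x (fun y => y i).
Proof.
exists 'X_i, 1, 0%N; split; [|exact: dhomog1|].
  by rewrite dhomogX /= mdeg1.
apply: near_inT => y; rewrite meval1 mevalXU divr1; split=> //.
exact/eqP/oner_neq0.
Qed.

End Geometry.

Definition vanishing (R : realType) (r : nat) (X : set (coords R r)) (x : X)
  : {pred coords R r -> R[i]} :=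
  fun f => `[< near_in X (val x) (fun y => f y = 0) >].

Section Germs.
Context {R : realType} {r : nat} (X : set (coords R r)).
Local Notation C := R[i].

Lemma vanishing_ideal (x : X) : idealr_closed (vanishing x).
Proof.
split.
- by apply/asboolP; apply: near_inT.
- apply/asboolP => -[q [d [_ qx /(_ (val x) (set_valP x) qx)]]].
  exact/eqP/oner_neq0.
- move=> a u v /asboolP hu /asboolP hv; apply/asboolP.
  apply: near_inW (near_inI hu hv) => y [uy vy].
  have -> : (a * u + v) y = a y * u y + v y by [].
  by rewrite uy vy mulr0 addr0.
Qed.
HB.instance Definition _ (x : X) :=
  isIdealr.Build (coords R r -> R[i]) (vanishing x) (vanishing_ideal x).

(* Germs at x of arbitrary functions on the cone over X. *)
Definition germs (x : X) := {ideal_quot (vanishing x)}.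
HB.instance Definition _ x := GRing.ComNzRing.on (germs x).
Definition germ (x : X) (f : coords R r -> C) : germs x :=
  (\pi_(germs x) f)%qT.

Lemma germE (x : X) f g :
  germ x f = germ x g <-> near_in X (val x) (fun y => f y = g y).
Proof.
split=> [/eqP|h].
  rewrite -Quotient.idealrBE => /asboolP; apply: near_inW => y /eqP.
  by rewrite subr_eq0 => /eqP.
apply/eqP; rewrite -Quotient.idealrBE; apply/asboolP; apply: near_inW h => y h.
by apply/eqP; rewrite subr_eq0; apply/eqP.
Qed.

End Germs.

Definition reg_germ (R : realType) (r : nat) (X : set (coords R r)) (x : X)
  (d : nat) : {pred germs x} :=
  fun g => `[< exists f, g = germ x f /\ regular_at d X (val x) f >].

Arguments reg_germ {R r X} x d.

Section Stalk.
Context {R : realType} {r : nat} (X : set (coords R r)) (x : X).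
Local Notation C := R[i].

Lemma reg_germP d a u v : a \in reg_germ x 0 -> u \in reg_germ x d ->
  v \in reg_germ x d -> a * u + v \in reg_germ x d.
Proof.
move=> /asboolP[f [-> hf]] /asboolP[g [-> hg]] /asboolP[h [-> hh]].
apply/asboolP; exists (f * g + h); split; last exact: regular_atP.
by rewrite /germ !piE.
Qed.
Lemma reg_germ_cst c : germ x (fun=> c) \in reg_germ x 0.
Proof. by apply/asboolP; eexists; split; last exact: regular_cst. Qed.

Lemma germ0 : germ x (fun=> 0) = 0.
Proof. by rewrite /germ !piE. Qed.
Lemma germ1 : germ x (fun=> 1) = 1.
Proof. by rewrite /germ !piE. Qed.

Lemma reg_germ_subring : subring_closed (reg_germ x 0).
Proof.
have r0 : 0 \in reg_germ x 0 by rewrite -germ0 reg_germ_cst.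
have r1 : 1 \in reg_germ x 0 by rewrite -germ1 reg_germ_cst.
have rM : {in reg_germ x 0 &, forall u v, u * v \in reg_germ x 0}.
  by move=> u v hu hv; rewrite -[u * v]addr0; apply: reg_germP.
split=> // u v hu hv; rewrite addrC -mulN1r; apply: reg_germP => //.
have -> : -1 = germ x (fun=> -1) by rewrite -germ1 /germ !piE.
exact: reg_germ_cst.
Qed.
HB.instance Definition _ :=
  GRing.isSubringClosed.Build (germs x) (reg_germ x 0) reg_germ_subring.

Definition local_ring := {g : germs x | g \in reg_germ x 0}.
HB.instance Definition _ := SubChoice.on local_ring.
HB.instance Definition _ := [SubChoice_isSubComNzRing of local_ring by <:].

Definition const_germ (c : C) : local_ring :=
  exist _ (germ x (fun=> c)) (reg_germ_cst c).
Lemma const_germ_additive : zmod_morphism const_germ.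
Proof. by move=> a b; apply: val_inj; rewrite /= /germ !piE. Qed.
Lemma const_germ_multiplicative : monoid_morphism const_germ.
Proof.
by split=> [|a b]; apply: val_inj; rewrite /= /germ !piE.
Qed.
HB.instance Definition _ :=
  GRing.isZmodMorphism.Build C local_ring const_germ const_germ_additive.
HB.instance Definition _ :=
  GRing.isMonoidMorphism.Build C local_ring const_germ const_germ_multiplicative.

Definition germ_mod := germs x.
HB.instance Definition _ := GRing.Zmodule.on germ_mod.
Definition germ_scale (a : local_ring) (g : germ_mod) : germ_mod := val a * g.
Lemma germ_scaleA a b g : germ_scale a (germ_scale b g) = germ_scale (a * b) g.
Proof. by rewrite /germ_scale rmorphM mulrA. Qed.
Lemma germ_scale1 : left_id 1 germ_scale.
Proof. by move=> g; rewrite /germ_scale rmorph1 mul1r. Qed.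
Lemma germ_scaleDr : right_distributive germ_scale +%R.
Proof. by move=> a g h; rewrite /germ_scale mulrDr. Qed.
Lemma germ_scaleDl g : {morph germ_scale^~ g : a b / a + b}.
Proof. by move=> a b; rewrite /germ_scale rmorphD mulrDl. Qed.
HB.instance Definition _ := GRing.Zmodule_isLmodule.Build local_ring germ_mod
  germ_scaleA germ_scale1 germ_scaleDr germ_scaleDl.

Lemma zero_reg d : 0 \in reg_germ x d.
Proof.
apply/asboolP; exists (fun=> 0); rewrite germ0; split=> //.
exists 0, 1, 0%N; split; [exact: dhomog0|exact: dhomog1|].
apply: near_inT => y; rewrite meval1 meval0 mul0r; split=> //.
exact/eqP/oner_neq0.
Qed.
Lemma reg_germ_smemP d (a : local_ring) (u v : germ_mod) :
  u \in reg_germ x d -> v \in reg_germ x d -> a *: u + v \in reg_germ x d.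
Proof. by move=> hu hv; apply: reg_germP => //; apply: valP. Qed.

(* The stalk of O_X(1) at x. *)
Definition stalk_L : lmodType local_ring :=
  sub_mod (Submodule (zero_reg 1) (@reg_germ_smemP 1)).

Lemma coord_germP i : germ x (fun y => y i)
  \in smemb (Submodule (zero_reg 1) (@reg_germ_smemP 1)).
Proof.
by apply/asboolP/asboolP; eexists; split; last exact: regular_coord.
Qed.
Definition coord_germ i : stalk_L := exist _ (germ x (fun y => y i)) (coord_germP i).

(* Kaehler differentials, principal parts and, for coherent sheaves, duals,
   derivations, tensor and symmetric powers commute with passage to stalks, so
   that the definitions for a linsys give here the stalks at x of the sheaves
   on X and of the maps between them. *)
Definition stalk : linsys C r :=
  @LinSys C r local_ring const_germ stalk_L coord_germ.

(* The germ of a regular function; 0 if f is not regular at x. *)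
Definition rgerm (f : coords R r -> C) : fring stalk :=
  insubd (0 : local_ring) (germ x f).

End Stalk.
Arguments stalk {R r X} x.
Arguments rgerm {R r X} x f.

Section Loci.
Context {R : realType} {r : nat} (X : set (coords R r)).
Local Notation C := R[i].

(* The points at which X is smooth of dimension n: over C, the nonsingular
   points of X if n = dim X. *)
Definition nonsingular n : set X :=
  [set x | free_of_rank (Omega (stalk x)) n].

Definition opens (U : set X) := exists W, open_in X W /\ U = [set x | W (val x)].

(* U_k: the union of the open sets with the defining property. *)
Definition locus_U n k : set X := [set x | exists U : set X,
  [/\ opens U, U `<=` nonsingular n, U x
    & forall i, (i <= k)%N -> exists e, forall y, U y ->
        free_of_rank (CokerA (stalk y) i) e]].

(* W is isomorphic to the closed subset Z of C^N defined by S: f is the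
   isomorphism W -> Z, and its inverse is locally given by polynomials h. *)
Definition is_affine (W : set X) := exists N (S : set {mpoly C[N]})
    (f : 'I_N -> coords R r -> C),
  let Z := [set z : 'I_N -> C | forall p, S p -> p.@[z] = 0] in
  [/\ forall i x, W x -> regular_at 0 X (val x) (f i),
      forall x, W x -> Z (fun i => f i (val x)),
      forall x y : X, W x -> W y -> (forall i, f i (val x) = f i (val y)) ->
        exists c, forall j, val y j = c * val x j
    & forall z, Z z -> exists h : 'I_r.+1 -> {mpoly C[N]},
        (fun j => (h j).@[z]) <> (fun=> 0) /\
        forall z', Z z' -> (fun j => (h j).@[z']) <> (fun=> 0) ->
          exists x : X, [/\ W x, val x = (fun j => (h j).@[z'])
            & forall i, f i (val x) = z' i]].

End Loci.

(* The relation between a map G : R_(k-1) -> S^k Omega and a map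
   delta : T -> Hom (P_(k-1)^* (x) L^*, R_(k-1)^* (x) L^* ), which are to be
   F^*_k and dg_(k-1):
     delta (d) o alpha_(k-1)^* = (G^T_d (x) L^* ) o pr_(k-1)
   for all vector fields d. *)
Definition corresponds (C : comNzRingType) (r : nat) (E : linsys C r) (k : nat)
    (G : lhom (Rk E k.-1) (sympow k (Omega E)))
    (delta : lhom (Tan E) (lhom (tens (dual (Pk E k.-1)) (Ld E))
                              (tens (dual (Rk E k.-1)) (Ld E)))) :=
  forall d D, delta $$ d $$ (alpha_dual E k.-1 $$ D)
    = ftwist_at G d $$ (pr_sym E k.-1 $$ D).

(* Main.v *)
(* Everything takes place in one stalk: A is the local ring, L is free of rank
   one on a nonvanishing coordinate, and Omega is free. Writing a basis of Omega
   through exact differentials gives functions g_j and derivations D_j with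
   w = sum_j <D_j, w> dg_j for all w; they need not form a basis, so A need not
   be known to be local. Since the factorials are invertible, the identities
   k! theta = sum_J <theta, dg_J> D_J and k! phi = sum_J <D_J, phi> dg_J make
   S^k T and S^k Omega perfectly dual. The symbol of a composition
   D_1 o ... o D_k o l is the permanent of the D_i(f_j), so operators detect
   S^k Omega (x) L inside P^k(L), and the fundamental form exists.
   After untwisting, both sides of the square send a row t in the kernel of
   alpha_(k-1) to (d o D)(alpha_k t): on the left because d acts on constant
   coefficients only, on the right because alpha_k t is the image of F^*_k.
   F^*_k is determined because the symbols of the d o D span S^k T (x) L^*, and
   dg_(k-1) because alpha_(k-1)^* is onto when the cokernel of alpha_(k-1) is
   free. *)
Require Import Defs.
From HB Require Import structures.
From mathcomp Require Import all_boot all_order all_algebra all_fingroup.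
From mathcomp Require Import generic_quotient ring_quotient.
From mathcomp Require Import boolp classical_sets functions cardinality fsbigop.
From mathcomp Require Import reals complex mpoly ring.
Set Implicit Arguments.
Unset Strict Implicit.
Unset Printing Implicit Defensive.
Import GRing.Theory.
Local Open Scope ring_scope.
Local Open Scope classical_set_scope.

(** * Universal properties of presented modules *)

Section Modules.
Context {A : comNzRingType}.
Implicit Types M N : lmodType A.

HB.instance Definition _ M N (f : lhom M N) :=
  GRing.isLinear.Build A M N _ (hom_fun f) (hom_fun_is_linear f).

Lemma hom_ext M N (f g : lhom M N) : (forall x, f $$ x = g $$ x) -> f = g.
Proof. by move=> fg; apply: val_inj; apply/funext. Qed.

Lemma sub_ext M (S : submodule M) (u v : sub_mod S) :
  sub_val u = sub_val v -> u = v.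
Proof. by move=> uv; apply: val_inj. Qed.

Lemma the_eltP M (P : M -> Prop) : (exists m, P m) -> P (the_elt P).
Proof. exact: xgetPex. Qed.

Lemma mkhomE M N (f : M -> N) (hf : is_linear f) x : mkhom hf $$ x = f x.
Proof. by []. Qed.

Lemma is_linear_0 M N (f : M -> N) : is_linear f -> f 0 = 0.
Proof. by move=> hf; rewrite -(mkhomE hf) linear0. Qed.

Lemma is_linear_Z M N (f : M -> N) a x : is_linear f -> f (a *: x) = a *: f x.
Proof. by move=> hf; rewrite -!(mkhomE hf) linearZ. Qed.

Lemma homD M N (f : lhom M N) u v : f $$ (u + v) = f $$ u + f $$ v.
Proof. exact: linearD. Qed.

Lemma homB M N (f : lhom M N) u v : f $$ (u - v) = f $$ u - f $$ v.
Proof. exact: linearB. Qed.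

Lemma homZ M N (f : lhom M N) a u : f $$ (a *: u) = a *: (f $$ u).
Proof. exact: linearZ. Qed.

Lemma hom_sum M N (f : lhom M N) I (s : seq I) (P : pred I) (F : I -> M) :
  f $$ (\sum_(i <- s | P i) F i) = \sum_(i <- s | P i) f $$ F i.
Proof. exact: linear_sum. Qed.

Lemma homDE M N (f g : lhom M N) x : (f + g) $$ x = f $$ x + g $$ x.
Proof. by []. Qed.

Lemma homZE M N a (f : lhom M N) x : (a *: f) $$ x = a *: (f $$ x).
Proof. by []. Qed.

Lemma hom0E M N x : (0 : lhom M N) $$ x = 0.
Proof. by []. Qed.

Lemma hom_sumE M N I (s : seq I) (P : pred I) (F : I -> lhom M N) x :
  (\sum_(i <- s | P i) F i) $$ x = \sum_(i <- s | P i) F i $$ x.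
Proof. by elim/big_rec2: _ => // i y1 y2 _ <-. Qed.

Lemma subDE M (S : submodule M) (u v : sub_mod S) :
  sub_val (u + v) = sub_val u + sub_val v.
Proof. by []. Qed.

Lemma subZE M (S : submodule M) a (u : sub_mod S) :
  sub_val (a *: u) = a *: sub_val u.
Proof. by []. Qed.

Definition mksub M (S : submodule M) w (Sw : S w) : sub_mod S :=
  exist (fun x => x \in smemb S) w (asboolT Sw).

Lemma sub_valP M (S : submodule M) (u : sub_mod S) : S (sub_val u).
Proof. by case: u => v Sv; apply/asboolP. Qed.

Lemma free_ind K (P : free_mod K -> Prop) : P 0 ->
  (forall a x u, P u -> P (a *: fgen x + u)) -> forall u : @free_mod A K, P u.
Proof.
move=> P0 Pc.
suff Pm v (Sv : span_mod (range (@indic A K)) v) : P (mksub Sv).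
  by move=> u; rewrite (_ : u = mksub (sub_valP u)) //; exact: sub_ext.
have h : gspan (range (@indic A K)) v := Sv.
elim: h Sv => [|a _ w [x _ <-] hw IH] Sv.
  by have -> : mksub Sv = 0 by apply: sub_ext.
have Sw : span_mod (range (@indic A K)) w by [].
have -> : mksub Sv = a *: fgen x + mksub Sw by exact: sub_ext.
exact/Pc/IH.
Qed.

(** Elements of [free_mod K] are functions of finite support, so the map sums [u x *: g x] over the
    support of [u]. *)
Lemma free_lift K N (g : K -> N) :
  exists f : lhom (free_mod K) N, forall x, f $$ fgen x = g x.
Proof.
pose T : choiceType := {classic K}.
pose c (u : free_mod K) : T -> A := sub_val u.
pose supp u := [set x : T | c u x != 0].
have fsupp u : finite_set (supp u).
  elim/free_ind: u => [|a y u fu].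
    by apply: (sub_finite_set _ (finite_set0 T)) => x /eqP.
  apply: (@sub_finite_set _ _ ([set (y : T)] `|` supp u)); last first.
    by rewrite finite_setU; split; [exact: finite_set1|].
  move=> x; apply: contra_neqP => /not_orP[xy /negP]; rewrite negbK => /eqP ux.
  rewrite -[LHS]/(a * (`[< x = y >])%:R + c u x) ux.
  by rewrite asboolF // mulr0 addr0.
pose h u : N := \sum_(x \in supp u) c u x *: g x.
(* Any duplicate-free list containing the support gives the same sum; one common list for [u] and
   [v] then yields linearity. *)
have hE u (r : seq T) : uniq r -> (forall x, c u x != 0 -> x \in r) ->
    h u = \sum_(x <- r) c u x *: g x.
  move=> ur ru; apply: fsbig_fwiden => // x [_ /=].
  by move/negP; rewrite negbK => /eqP ->; rewrite scale0r.
have hlin : is_linear h.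
  move=> a u v.
  have /finite_seqP[r0 r0E] : finite_set (supp u `|` supp v).
    by rewrite finite_setU; split; exact: fsupp.
  pose r := undup r0; have ur : uniq r := undup_uniq r0.
  have inr x : c u x != 0 \/ c v x != 0 -> x \in r.
    rewrite mem_undup => cx; have : [set` r0] x by rewrite -r0E.
    by [].
  have cE x : c (a *: u + v) x = a * c u x + c v x by [].
  rewrite (hE u r ur) => [|x ux]; last by apply: inr; left.
  rewrite (hE v r ur) => [|x vx]; last by apply: inr; right.
  rewrite (hE _ r ur) => [|x]; last first.
    rewrite cE => ux; apply: inr.
    have [u0|] := eqVneq (c u x) 0; [right|by left].
    by move: ux; rewrite u0 mulr0 add0r.
  rewrite scaler_sumr -big_split; apply: eq_bigr => x _.
  by rewrite cE scalerDl scalerA.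
exists (mkhom hlin) => x.
have cE y : c (fgen x) y = `[< y = x >]%:R by [].
rewrite mkhomE (hE _ [:: (x : T)]) //; last first.
  by move=> y; rewrite cE inE; case: asboolP => [->|]; rewrite ?eqxx.
by rewrite big_seq1 cE asboolT // scale1r.
Qed.

Lemma proj_is_linear M (S : submodule M) a u v :
  proj S (a *: u + v) = a *: (proj S u : quot_mod S) + proj S v.
Proof. by rewrite projD -projZ. Qed.

Definition projh M (S : submodule M) : lhom M (quot_mod S) :=
  mkhom (@proj_is_linear M S).

Lemma pres_rel K (G : @free_mod A K -> Prop) u :
  G u -> projh (span_mod G) $$ u = 0.
Proof.
move=> Gu; rewrite -(linear0 (hom_fun (projh (span_mod G)))).
apply/(proj_eq (span_mod G)); rewrite subr0 -[u]addr0 -[u]scale1r.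
exact: gspan_cons (gspan_nil _).
Qed.

Lemma pres_ind K (G : @free_mod A K -> Prop) (P : pres G -> Prop) : P 0 ->
  (forall a x y, P y -> P (a *: gen G x + y)) -> forall y, P y.
Proof.
move=> P0 Pc y; have [u ->] := projP y; elim/free_ind: u => [|a x u IH].
  have := proj_is_linear (span_mod G) (-1) 0 0.
  by rewrite scaler0 add0r scaleN1r addNr => ->.
by rewrite proj_is_linear; apply: Pc.
Qed.

Lemma pres_ext K (G : @free_mod A K -> Prop) N (f g : lhom (pres G) N) :
  (forall x, f $$ gen G x = g $$ gen G x) -> f = g.
Proof.
move=> fg; apply: hom_ext; elim/pres_ind => [|a x y IH].
  by rewrite !linear0.
by rewrite !hom_fun_is_linear IH fg.
Qed.

(** [extend] is a choice by [the_elt], so its values are known only once such a map exists. A lift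
    to the free module kills the relations, hence their span, and descends to the quotient. *)
Lemma extendE K (G : @free_mod A K -> Prop) N (g : K -> N) :
  (forall f : lhom (free_mod K) N, (forall x, f $$ fgen x = g x) ->
     forall u, G u -> f $$ u = 0) ->
  forall x, extend G g $$ gen G x = g x.
Proof.
move=> gG.
suff h : exists f : lhom (pres G) N, forall x, f $$ gen G x = g x.
  exact: (the_eltP h).
have [f fE] := free_lift g.
have fspan u : gspan G u -> f $$ u = 0.
  elim=> [|a v w Gv _ IH]; first by rewrite linear0.
  by rewrite hom_fun_is_linear IH (gG f fE) // scaler0 addr0.
pose h (y : pres G) : N := f $$ sval (cid (projP y)).
have hE u : h (proj (span_mod G) u) = f $$ u.
  rewrite /h; case: cid => v /= uv; apply/eqP.
  by rewrite -subr_eq0 -linearB; apply/eqP/fspan/(proj_eq (span_mod G)).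
have hlin : is_linear h.
  move=> a y z; have [u ->] := projP y; have [v ->] := projP z.
  by rewrite -proj_is_linear !hE hom_fun_is_linear.
by exists (mkhom hlin) => x; rewrite mkhomE hE fE.
Qed.

End Modules.

(** * Tensor and symmetric powers *)

Section TensSym.
Context {A : comNzRingType}.
Implicit Types M N P : lmodType A.

Lemma tprod_linearl M N n : is_linear (fun m : M => tprod m n : tens M N).
Proof.
move=> a u v; have := pres_rel (tens_l a u v n).
by rewrite linearB linearD linearZ => /subr0_eq.
Qed.

Lemma tprod_linearr M N m : is_linear (fun n : N => tprod m n : tens M N).
Proof.
move=> a u v; have := pres_rel (tens_r a m u v).
by rewrite linearB linearD linearZ => /subr0_eq.
Qed.

Lemma tens_extendE M N P (g : M -> N -> P) :
  (forall n, is_linear (g^~ n)) -> (forall m, is_linear (g m)) ->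
  forall m n,
    extend (@tens_rel A M N) (fun q => g q.1 q.2) $$ tprod m n = g m n.
Proof.
move=> gl gr m n; rewrite /tprod extendE // => f fE _ [a m1 m2 n1|a m1 n1 n2].
  by rewrite homB hom_fun_is_linear !fE gl subrr.
by rewrite homB hom_fun_is_linear !fE gr subrr.
Qed.

Lemma tens_lift M N P (g : M -> N -> P) :
  (forall n, is_linear (g^~ n)) -> (forall m, is_linear (g m)) ->
  exists f : lhom (tens M N) P, forall m n, f $$ tprod m n = g m n.
Proof.
move=> gl gr; exists (extend (@tens_rel A M N) (fun q => g q.1 q.2)).
exact: tens_extendE.
Qed.

Lemma tens_ext M N P (f g : lhom (tens M N) P) :
  (forall m n, f $$ tprod m n = g $$ tprod m n) -> f = g.
Proof. by move=> fg; apply: pres_ext => -[]. Qed.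

Lemma upd_same k M (t : 'I_k -> M) i u : upd t i u i = u.
Proof. by rewrite /upd eqxx. Qed.

Definition multilinear k M N (g : ('I_k -> M) -> N) :=
  forall t i, is_linear (fun u => g (upd t i u)).
Definition symmetric_fun k M N (g : ('I_k -> M) -> N) :=
  forall (s : 'S_k) t, g (fun i => t (s i)) = g t.

Lemma sprod_multilinear k M : multilinear (@sprod A k M).
Proof.
move=> t i a u v; have := pres_rel (sym_lin i a u v t).
by rewrite linearB linearD linearZ => /subr0_eq.
Qed.

Lemma sprod_sym k M : symmetric_fun (@sprod A k M).
Proof.
by move=> s t; have := pres_rel (sym_perm s t); rewrite linearB => /subr0_eq.
Qed.

Lemma sym_extendE k M N (g : ('I_k -> M) -> N) :
  multilinear g -> symmetric_fun g ->
  forall t, extend (@sym_rel A k M) g $$ sprod t = g t.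
Proof.
move=> gl gs t; rewrite /sprod extendE // => f fE _ [i a u v t'|s t'].
  by rewrite linearB /= hom_fun_is_linear !fE gl subrr.
by rewrite linearB /= !fE gs subrr.
Qed.

Lemma sym_ext k M N (f g : lhom (sympow k M) N) :
  (forall t, f $$ sprod t = g $$ sprod t) -> f = g.
Proof. exact: pres_ext. Qed.

(** * Slot-by-slot expansion of functions of several arguments *)

Definition fcons k (S : Type) (x : S) (t : 'I_k -> S) : 'I_k.+1 -> S :=
  fun i => oapp t x (unlift ord0 i).

Lemma fcons0 k S (x : S) (t : 'I_k -> S) : fcons x t ord0 = x.
Proof. by rewrite /fcons unlift_none. Qed.

Lemma fconsS k S (x : S) (t : 'I_k -> S) i : fcons x t (lift ord0 i) = t i.
Proof. by rewrite /fcons liftK. Qed.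

Lemma fcons_eta k S (t : 'I_k.+1 -> S) :
  fcons (t ord0) (fun i => t (lift ord0 i)) = t.
Proof. by apply/funext => i; rewrite /fcons; case: unliftP => [j|] ->. Qed.

Lemma upd_fcons0 k M (x y : M) (t : 'I_k -> M) :
  upd (fcons x t) ord0 y = fcons y t.
Proof.
apply/funext => i; rewrite /upd; case: eqP => [->|]; first by rewrite fcons0.
by rewrite /fcons; case: unliftP => [j ->|->].
Qed.

Lemma upd_fconsS k M (x y : M) (t : 'I_k -> M) i :
  upd (fcons x t) (lift ord0 i) y = fcons x (upd t i y).
Proof.
apply/funext => j; rewrite /upd /fcons; case: (unliftP ord0 j) => [l|] -> /=.
  by rewrite (inj_eq lift_inj).
by [].
Qed.

Lemma big_fcons N k p (F : ('I_k.+1 -> 'I_p) -> N) :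
  \sum_(J : {ffun 'I_k.+1 -> 'I_p}) F J
  = \sum_j \sum_(J : {ffun 'I_k -> 'I_p}) F (fcons j J).
Proof.
pose h (q : 'I_p * {ffun 'I_k -> 'I_p}) := finfun (fcons q.1 q.2).
rewrite pair_big /= (reindex h) /=.
  by apply: eq_bigr => q _; congr F; apply/funext => i; rewrite ffunE.
exists (fun J => (J ord0, [ffun i => J (lift ord0 i)])).
  move=> [j J] _; rewrite ffunE fcons0; congr (_, _).
  by apply/ffunP => i; rewrite !ffunE fconsS.
move=> J _; apply/ffunP => i; rewrite ffunE.
transitivity (fcons (J ord0) (fun i => J (lift ord0 i)) i).
  by rewrite /fcons; case: (unlift ord0 i) => //= l; rewrite ffunE.
by rewrite fcons_eta.
Qed.

(** Only an expansion in each slot is assumed, not linearity, so this also applies to functions that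
    are derivations in each slot. The induction expands slot [ord0] first. *)
Lemma slot_expand k M N p (c : 'I_p -> M -> A) (g : 'I_p -> M)
    (F : ('I_k -> M) -> N) :
  (forall t i x, F (upd t i x) = \sum_j c j x *: F (upd t i (g j))) ->
  forall t, F t = \sum_(J : {ffun 'I_k -> 'I_p})
     (\prod_i c (J i) (t i)) *: F (fun i => g (J i)).
Proof.
elim: k F => [|k IH] F FE t.
  rewrite (eq_bigr (fun _ => F t)) => [|J _]; last first.
    by rewrite big_ord0 scale1r; congr F; apply/funext => -[].
  by rewrite sumr_const card_ffun !card_ord expn0 mulr1n.
rewrite (@big_fcons _ _ _
  (fun J => (\prod_i c (J i) (t i)) *: F (fun i => g (J i)))).
rewrite -[in LHS](fcons_eta t) -(upd_fcons0 (t ord0)) FE.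
apply: eq_bigr => j _; rewrite upd_fcons0.
rewrite (IH (fun t' => F (fcons (g j) t'))) => [|t' i x]; last first.
  by rewrite -upd_fconsS FE; apply: eq_bigr => l _; rewrite upd_fconsS.
rewrite scaler_sumr; apply: eq_bigr => J _.
rewrite scalerA big_ord_recl fcons0; congr (_ * _ *: F _).
  by apply: eq_bigr => i _; rewrite fconsS.
rewrite -[RHS]fcons_eta fcons0; congr fcons.
by apply/funext => i; rewrite fconsS.
Qed.

Lemma multilinear_expand k M N p (c : 'I_p -> M -> A) (g : 'I_p -> M)
    (F : ('I_k -> M) -> N) :
  multilinear F -> (forall x, x = \sum_j c j x *: g j) ->
  forall t, F t = \sum_(J : {ffun 'I_k -> 'I_p})
     (\prod_i c (J i) (t i)) *: F (fun i => g (J i)).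
Proof.
move=> Fl xE; apply: slot_expand => t i x.
rewrite -[LHS]/(mkhom (Fl t i) $$ x) {1}(xE x) linear_sum.
by apply: eq_bigr => j _; rewrite linearZ.
Qed.

(** * Permanents and the Casimir identity *)

Section Permanent.
Context {M N : lmodType A} (k : nat) (b : M -> N -> A^o).
Definition permanent (t : 'I_k -> M) (w : 'I_k -> N) : A^o :=
  \sum_(s : 'S_k) \prod_i b (t i) (w (s i)).

Lemma permanent_multilinear t :
  (forall m, is_linear (b m)) -> multilinear (permanent t).
Proof.
move=> bl w j a u v; rewrite /permanent scaler_sumr -big_split /=.
apply: eq_bigr => s _.
(* For fixed [s], slot [j] of [w] enters a single factor, the one with index [s^-1 j]. *)
have E x : \prod_i b (t i) (upd w j x (s i))
    = b (t (s^-1 j)%g) x * \prod_(i | i != (s^-1 j)%g) b (t i) (w (s i)).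
  rewrite (bigD1 (s^-1 j)%g) //= permKV upd_same; congr (_ * _).
  apply: eq_bigr => i ij; rewrite /upd ifN //.
  by apply: contra ij => /eqP <-; rewrite permK.
by rewrite !E bl mulrDl -mulrA.
Qed.

Lemma permanent_symmetric t : symmetric_fun (permanent t).
Proof.
move=> s w; rewrite /permanent (reindex_inj (mulIg s^-1)%g) /=.
apply: eq_bigr => s' _; apply: eq_bigr => i _.
by rewrite permM permKV.
Qed.
End Permanent.

Lemma permanent_flip M N k (b : M -> N -> A^o) (t : 'I_k -> M) w :
  permanent b t w = permanent (fun n m => b m n) w t.
Proof.
rewrite /permanent (reindex_inj invg_inj) /=; apply: eq_bigr => s _.
rewrite (reindex_inj (@perm_inj _ s)) /=.
by apply: eq_bigr => i _; rewrite permK.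
Qed.

(** On a product [sprod t], expanding the permanent over [s] and summing over [J] gives [sprod t]
    with its factors permuted by [s], that is [sprod t] again, for each of the [k!] permutations. *)
Lemma casimir k M N p (x : 'I_p -> M) (y : 'I_p -> N) (b : M -> N -> A^o)
    (B : sympow k M -> sympow k N -> A^o) :
  (forall m, m = \sum_j b m (y j) *: x j) ->
  (forall phi, is_linear (B^~ phi)) ->
  (forall t w, B (sprod t) (sprod w) = permanent b t w) ->
  forall theta, k`!%:R *: theta = \sum_(J : {ffun 'I_k -> 'I_p})
    B theta (sprod (fun i => y (J i))) *: sprod (fun i => x (J i)).
Proof.
move=> xE Bl BE theta.
have rl : is_linear (fun theta => \sum_(J : {ffun 'I_k -> 'I_p})
    B theta (sprod (fun i => y (J i))) *: sprod (fun i => x (J i))).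
  move=> a u v; rewrite scaler_sumr -big_split /=; apply: eq_bigr => J _.
  by rewrite Bl scalerDl scalerA.
have ll : is_linear (fun theta : sympow k M => k`!%:R *: theta).
  by move=> a u v; rewrite scalerDr !scalerA mulrC.
rewrite -[LHS]/(mkhom ll $$ theta) -[RHS]/(mkhom rl $$ theta).
congr hom_fun; apply: sym_ext => t; rewrite !mkhomE.
under [RHS]eq_bigr => J _.
  rewrite BE permanent_flip /permanent scaler_suml; over.
rewrite exchange_big /= (eq_bigr (fun=> sprod t)) => [|s _]; last first.
  rewrite -[RHS](sprod_sym s t).
  by rewrite (multilinear_expand (@sprod_multilinear k M) xE).
by rewrite sumr_const -scaler_nat card_Sn.
Qed.

End TensSym.

(** * Differentials and derivations *)

(** Uniqueness of the coordinates makes them linear. *)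
Lemma basis_coord (A : comNzRingType) (M : lmodType A) n (b : 'I_n -> M) :
  is_basis b ->
  exists c : 'I_n -> dual M, forall m, m = \sum_i (c i $$ m : A) *: b i.
Proof.
move=> hb; pose c m := sval (cid (hb m)).
have cE m : m = \sum_i c m i *: b i by rewrite /c; case: cid => a [].
have cU m a : m = \sum_i a i *: b i -> c m = a.
  by rewrite /c; case: cid => a' [_ aU] /= /aU.
have cl i : is_linear (fun m => c m i : A^o).
  move=> a u v; rewrite (cU (a *: u + v) (fun i => a * c u i + c v i)) //.
  rewrite {1}(cE u) {1}(cE v) scaler_sumr -big_split; apply: eq_bigr => j _.
  by rewrite scalerDl scalerA.
by exists (fun i => mkhom (cl i)) => m; rewrite {1}(cE m).
Qed.

Section Differentials.
Context {C : comNzRingType} {r : nat} (E : linsys C r).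
Local Notation A := (fring E).
Local Notation Omega := (Omega E).
Local Notation Tan := (Tan E).
Local Notation dif := (@dif C r E).

Definition derivation_into (N : lmodType A) (D : A -> N) :=
  [/\ forall f g, D (f + g) = D f + D g,
      forall f g, D (f * g) = f *: D g + g *: D f
    & forall c, D (const E c) = 0].

Lemma kahler_extendE (N : lmodType A) (D : A -> N) : derivation_into D ->
  forall f, extend (@kahler_rel C r E) D $$ dif f = D f.
Proof.
move=> [hD hM hC] f; rewrite /dif extendE // => F FE _ [g h|g h|c].
- by rewrite linearB linearD /= !FE hD subrr.
- by rewrite linearB linearD !linearZ /= !FE hM subrr.
- by rewrite FE hC.
Qed.

Lemma vf_funP a (u v : Tan) f :
  vf_fun (a *: u + v) f = a * vf_fun u f + vf_fun v f.
Proof. by rewrite /vf_fun subDE subZE. Qed.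

Lemma contrE (D : Tan) f : contr D $$ dif f = vf_fun D f.
Proof.
have [hD hM hC] : derivations E (vf_fun D) := sub_valP D.
by rewrite /contr kahler_extendE.
Qed.

Lemma Omega_ext (N : lmodType A) (f g : lhom Omega N) :
  (forall h, f $$ dif h = g $$ dif h) -> f = g.
Proof. exact: pres_ext. Qed.

Lemma dif_derivation : derivation_into dif.
Proof.
split=> [f g|f g|c].
- have := pres_rel (kahler_add f g).
  by rewrite linearB linearD => /subr0_eq.
- have := pres_rel (kahler_mul f g).
  by rewrite linearB linearD !linearZ => /subr0_eq.
- exact: (pres_rel (@kahler_cst C r E c)).
Qed.

Lemma dual_derivation (c : dual Omega) : derivations E (fun f => c $$ dif f).
Proof.
have [hD hM hC] := dif_derivation; split=> [f g|f g|a].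
- by rewrite hD linearD.
- by rewrite hM linearD !linearZ.
- by rewrite hC linear0.
Qed.

Lemma contr_surj (c : dual Omega) : exists D : Tan, contr D = c.
Proof.
by exists (mksub (dual_derivation c)); apply: Omega_ext => h; rewrite contrE.
Qed.

(* The dg_j generate Omega but may be linearly dependent. *)
Definition exact_dual_basis p (g : 'I_p -> A) (D : 'I_p -> Tan) :=
  forall w : Omega, w = \sum_j (contr (D j) $$ w : A) *: dif (g j).

Lemma exact_dual_basis_exists n : free_of_rank Omega n ->
  exists p (g : 'I_p -> A) (D : 'I_p -> Tan), exact_dual_basis g D.
Proof.
move=> [b /basis_coord[c cE]].
(* [rep F] says that [F] is a finite sum of maps [w |-> e(w) df]. Coefficients are absorbed into the
   functionals [e], so the differentials stay exact. *)
pose rep (F : Omega -> Omega) := exists s : seq (dual Omega * A),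
  forall w, F w = \sum_(q <- s) (q.1 $$ w : A) *: dif q.2.
have rep1 (e : dual Omega) v : rep (fun w => (e $$ w : A) *: v).
  move: v; apply: (@pres_ind _ _ (@kahler_rel C r E)) => [|a f v [s sE]].
    by exists [::] => w; rewrite big_nil scaler0.
  exists ((a *: e, f) :: s) => w; rewrite big_cons -sE scalerDr scalerA /=.
  by rewrite homZE mulrC.
have repS (q : seq 'I_n) : rep (fun w => \sum_(i <- q) (c i $$ w : A) *: b i).
  elim: q => [|i q [s sE]]; first by exists [::] => w; rewrite !big_nil.
  have [s' s'E] := rep1 (c i) (b i).
  by exists (s' ++ s) => w; rewrite big_cons big_cat /= sE s'E.
have [s sE] := repS (index_enum _).
pose q j := tnth (in_tuple s) j.
have [D DE] := choice (fun j => contr_surj (q j).1).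
exists (size s), (fun j => (q j).2), D => w.
rewrite [LHS]cE sE (big_tnth _ _ s); apply: eq_bigr => j _.
by rewrite DE.
Qed.

Lemma exact_dual_basis_tan p (g : 'I_p -> A) (D : 'I_p -> Tan) :
  exact_dual_basis g D ->
  forall t : Tan, t = \sum_j (contr t $$ dif (g j) : A) *: D j.
Proof.
move=> gD t; apply: sub_ext; apply/funext => f.
have valS (I : Type) (s : seq I) (F : I -> Tan) :
    vf_fun (\sum_(i <- s) F i) f = \sum_(i <- s) vf_fun (F i) f.
  by elim/big_rec2: _ => // i y1 y2 _ <-.
rewrite -[LHS]/(vf_fun t f) -[RHS]/(vf_fun _ f) valS -contrE {1}(gD (dif f)).
rewrite linear_sum; apply: eq_bigr => j _.
by rewrite linearZ contrE /vf_fun subZE; exact: mulrC.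
Qed.

Lemma contr_linear (w : Omega) : is_linear (fun t : Tan => contr t $$ w).
Proof.
move=> a u v; rewrite -homZE -homDE; congr hom_fun.
by apply: Omega_ext => f; rewrite homDE homZE !contrE vf_funP.
Qed.

Definition contr_perm k := @permanent _ Tan Omega k (fun t w => contr t $$ w).

(** [sym_pairing] nests two [extend]s; each computes once the permanent is multilinear and symmetric
    in its own argument, and [permanent_flip] exchanges the two. *)
Lemma sym_pairingE k (t : 'I_k -> Tan) (w : 'I_k -> Omega) :
  sym_pairing E k $$ sprod t $$ sprod w = contr_perm t w.
Proof.
have inner (t' : 'I_k -> Tan) w' :
    extend (@sym_rel _ k Omega) (contr_perm t') $$ sprod w' = contr_perm t' w'.
  apply: sym_extendE; last exact: permanent_symmetric.
  by apply: permanent_multilinear => m; apply: hom_fun_is_linear.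
have -> : sym_pairing E k $$ sprod t
    = extend (@sym_rel _ k Omega) (contr_perm t); last exact: inner.
apply: (sym_extendE (g := fun D => extend (@sym_rel _ k Omega) (contr_perm D))).
  move=> t' i a u v; apply: sym_ext => w'; rewrite homDE homZE !inner.
  rewrite /contr_perm !(permanent_flip _ _ w').
  by apply: permanent_multilinear => m; exact: contr_linear.
move=> s t'; apply: sym_ext => w'; rewrite !inner.
rewrite /contr_perm !(permanent_flip _ _ w').
exact: permanent_symmetric.
Qed.

Section Casimir.
Context (p : nat) (g : 'I_p -> A) (D : 'I_p -> Tan) (gD : exact_dual_basis g D).

Lemma casimir_tan k (theta : sympow k Tan) :
  k`!%:R *: theta = \sum_(J : {ffun 'I_k -> 'I_p})
    (sym_pairing E k $$ theta $$ sprod (fun i => dif (g (J i))) : A)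
      *: sprod (fun i => D (J i)).
Proof.
apply: (casimir (y := fun j => dif (g j)) (b := fun t w => contr t $$ w)
  (B := fun u v => sym_pairing E k $$ u $$ v)).
- exact: exact_dual_basis_tan gD.
- by move=> phi a u v; rewrite hom_fun_is_linear homDE homZE.
- exact: sym_pairingE.
Qed.

Lemma casimir_omega k (phi : sympow k Omega) :
  k`!%:R *: phi = \sum_(J : {ffun 'I_k -> 'I_p})
    (sym_pairing E k $$ sprod (fun i => D (J i)) $$ phi : A)
      *: sprod (fun i => dif (g (J i))).
Proof.
apply: (casimir (x := fun j => dif (g j)) (b := fun w t => contr t $$ w)
  (B := fun v u => sym_pairing E k $$ u $$ v)).
- exact: gD.
- by move=> psi; exact: hom_fun_is_linear.
- by move=> t w; rewrite sym_pairingE /contr_perm permanent_flip.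
Qed.
End Casimir.

End Differentials.

(** * Principal parts and differential operators *)

Section Commutators.
Context {C : comNzRingType} {r : nat} (E : linsys C r).
Local Notation A := (fring E).
Local Notation L := (bundle E).

Definition base_linear (N : lmodType A) (D : L -> N) :=
  (forall u v, D (u + v) = D u + D v) /\
  (forall c m, D (const E c *: m) = const E c *: D m).

(** Grothendieck's differential operators of order at most [k]. *)
Definition diffop (k : nat) (N : lmodType A) (D : L -> N) :=
  base_linear D /\
  forall fs, size fs = k.+1 -> forall m, iter_comm fs D m = 0.

Lemma iter_comm_cons (N : lmodType A) f fs (D : L -> N) m :
  iter_comm (f :: fs) D m = iter_comm fs D (f *: m) - f *: iter_comm fs D m.
Proof. by []. Qed.

Lemma iter_comm_hom (N P : lmodType A) (h : lhom N P) fs (D : L -> N) m :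
  h $$ iter_comm fs D m = iter_comm fs (fun m => h $$ D m) m.
Proof.
elim: fs m => [//|f fs IH] m.
by rewrite !iter_comm_cons linearB linearZ /= !IH.
Qed.

Lemma iter_comm_base_linear (N : lmodType A) fs (D : L -> N) :
  base_linear D -> base_linear (iter_comm fs D).
Proof.
move=> [hD hC]; elim: fs => [//|f fs [IHD IHC]]; split=> [u v|c m].
  by rewrite !iter_comm_cons !(IHD, scalerDr) opprD addrACA.
rewrite !iter_comm_cons IHC scalerA [f * _]mulrC -scalerA IHC.
by rewrite scalerBr !scalerA [f * _]mulrC.
Qed.

Lemma iter_comm_swap (N : lmodType A) f fs1 fs2 (D : L -> N) m :
  iter_comm (fs1 ++ f :: fs2) D m = iter_comm (f :: fs1 ++ fs2) D m.
Proof.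
elim: fs1 m => [//|g fs1 IH] m; rewrite !cat_cons iter_comm_cons !IH.
rewrite !iter_comm_cons !scalerBr !scalerA [g * f]mulrC !opprB.
by rewrite addrACA [RHS]addrACA; congr (_ + _); rewrite addrC.
Qed.

Lemma iter_comm_perm (N : lmodType A) fs fs' (D : L -> N) m :
  perm_eq fs fs' -> iter_comm fs D m = iter_comm fs' D m.
Proof.
elim: fs fs' m => [|f fs IH] fs' m pe.
  by case: fs' pe => // a l /perm_size.
have fin : f \in fs' by rewrite -(perm_mem pe) mem_head.
case/splitPr: fs' / fin pe => fs1 fs2 pe.
rewrite iter_comm_swap !iter_comm_cons -!(IH (fs1 ++ fs2)) //.
all: rewrite -(perm_cons f) (perm_trans pe) //.
all: by rewrite perm_catC /= perm_cons perm_catC.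
Qed.

Lemma iter_commD (N : lmodType A) f g fs (D : L -> N) m : base_linear D ->
  iter_comm (f + g :: fs) D m
  = iter_comm (f :: fs) D m + iter_comm (g :: fs) D m.
Proof.
move=> /(iter_comm_base_linear fs)[hD _]; rewrite !iter_comm_cons.
by rewrite !scalerDl hD opprD addrACA.
Qed.

(** With δf = 1⊗f - f⊗1 this is δ(fg) = f δg + g δf + δg δf; the quadratic term is the obstruction
    to the derivation rule. *)
Lemma iter_commM (N : lmodType A) f g fs (D : L -> N) m :
  iter_comm (f * g :: fs) D m = f *: iter_comm (g :: fs) D m
    + g *: iter_comm (f :: fs) D m + iter_comm (g :: f :: fs) D m.
Proof.
rewrite !iter_comm_cons !scalerBr !scalerA [g * f]mulrC.
by rewrite addrACA subrr addr0 [RHS]addrC addrA subrK.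
Qed.

Lemma iter_comm_const (N : lmodType A) c fs (D : L -> N) m : base_linear D ->
  iter_comm (const E c :: fs) D m = 0.
Proof.
move=> /(iter_comm_base_linear fs)[_ hC].
by rewrite iter_comm_cons hC subrr.
Qed.

Lemma PP_extendE k (N : lmodType A) (D : L -> N) : diffop k D ->
  forall m, extend (@pp_rel C r E k) D $$ pd k m = D m.
Proof.
move=> [[hD hC] hI] m; rewrite /pd extendE // => F FE _ [m1 m2|c m1|fs m1 sz].
- by rewrite linearB linearD /= !FE hD subrr.
- by rewrite linearB linearZ /= !FE hC subrr.
- rewrite iter_comm_hom (_ : (fun m => _) = D) ?hI //.
  by apply/funext => m2; rewrite FE.
Qed.

Lemma PP_lift k (N : lmodType A) (D : L -> N) : diffop k D ->
  exists F : lhom (PP E k) N, forall m, F $$ pd k m = D m.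
Proof.
by move=> hD; exists (extend (@pp_rel C r E k) D); apply: PP_extendE.
Qed.

Lemma pd_diffop k : diffop k (@pd C r E k).
Proof.
split; first split=> [u v|c m].
- have := pres_rel (@pp_add C r E k u v).
  by rewrite linearB linearD => /subr0_eq.
- have := pres_rel (@pp_scale C r E k c m).
  by rewrite linearB linearZ => /subr0_eq.
- by move=> fs sz m; have := pres_rel (pp_ideal m sz); rewrite iter_comm_hom.
Qed.

Lemma hom_diffop k (N : lmodType A) (F : lhom (PP E k) N) :
  diffop k (fun m => F $$ pd k m).
Proof.
have [[hD hC] hI] := pd_diffop k; split; first split=> [u v|c m].
- by rewrite hD linearD.
- by rewrite hC linearZ.
- by move=> fs sz m; rewrite -iter_comm_hom hI // linear0.
Qed.

(** [k] commutators bring the order down to 0, and the failure of A-linearity is one further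
    commutator, which vanishes. *)
Lemma diffop_linear k (N : lmodType A) (D : L -> N) fs : diffop k D ->
  size fs = k -> is_linear (iter_comm fs D).
Proof.
move=> [hb hI] sz a u v; have [hD _] := iter_comm_base_linear fs hb.
rewrite hD; congr (_ + _); apply/subr0_eq.
by rewrite -[LHS]iter_comm_cons hI //= sz.
Qed.

Definition fseq k (S : Type) (t : 'I_k -> S) : seq S :=
  [seq t i | i <- enum 'I_k].

Lemma size_fseq k S (t : 'I_k -> S) : size (fseq t) = k.
Proof. by rewrite size_map size_enum_ord. Qed.

Lemma fseq_upd k (M : lmodType A) (t : 'I_k -> M) i x :
  perm_eq (fseq (upd t i x)) (x :: [seq t j | j <- rem i (enum 'I_k)]).
Proof.
have pe : perm_eq (enum 'I_k) (i :: rem i (enum 'I_k)).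
  by apply: perm_to_rem; rewrite mem_enum.
rewrite (permPl (perm_map _ pe)) /= upd_same.
rewrite (_ : map _ _ = [seq t j | j <- rem i (enum 'I_k)]) //.
apply/eq_in_map => j; rewrite rem_filter ?enum_uniq // mem_filter /=.
by rewrite /upd => /andP[/negPf ->].
Qed.

Lemma fseq_perm k (S : eqType) (t : 'I_k -> S) (s : 'S_k) :
  perm_eq (fseq (fun i => t (s i))) (fseq t).
Proof.
rewrite /fseq (map_comp t s); apply: perm_map; apply: uniq_perm.
- by rewrite map_inj_uniq ?enum_uniq //; exact: perm_inj.
- exact: enum_uniq.
- move=> i; rewrite mem_enum; apply/mapP; exists ((s^-1)%g i).
    by rewrite mem_enum.
  by rewrite permKV.
Qed.

Section SymIncl.
Context (k : nat).

(* The elements f_1, ..., f_k of A give (1 (x) f_1 - f_1 (x) 1) ...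
   (1 (x) f_k - f_k (x) 1) in P^k; being killed by one more factor, this is
   A-linear in L and a derivation in each f_i. *)
Definition symm_fun (t : 'I_k -> A^o) : lhom L (PP E k) :=
  mkhom (diffop_linear (pd_diffop k) (size_fseq (t : 'I_k -> A))).

Lemma symm_fun_slot t i :
  derivation_into (fun f : A => symm_fun (upd t i (f : A^o))).
Proof.
have [hb hI] := pd_diffop k.
have slotE x m : symm_fun (upd t i (x : A^o)) $$ m =
    iter_comm (x :: [seq t j | j <- rem i (enum 'I_k)]) (@pd C r E k) m.
  by rewrite mkhomE; apply: iter_comm_perm; apply: fseq_upd.
split=> [f g|f g|c]; apply: hom_ext => m; rewrite ?homDE ?homZE !slotE.
- exact: iter_commD.
(* In the quadratic term two commutators replace one, which makes [k.+1] of them, so it vanishes in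
   P^k(L). *)
- rewrite iter_commM (hI [:: g, f & _]) ?addr0 //=.
  rewrite size_map size_rem ?mem_enum //.
  by rewrite size_enum_ord prednK // (leq_ltn_trans _ (ltn_ord i)).
- exact: iter_comm_const.
Qed.

Lemma symm_fun_sym : symmetric_fun symm_fun.
Proof.
move=> s t; apply: hom_ext => m; rewrite !mkhomE.
exact/iter_comm_perm/fseq_perm.
Qed.

Context (p : nat) (g : 'I_p -> A) (D : 'I_p -> Tan E).
Context (gD : exact_dual_basis g D).

(** The required values concern exact forms only. The map is defined through the expansion along the
    [dif (g j)], which is multilinear and symmetric by construction, and is then compared with
    commutators on exact forms. *)
Lemma sym_incl_exists : exists f : lhom (tens (sympow k (Omega E)) L) (PP E k),
  forall (fs : k.-tuple A) m,
    f $$ tprod (sprod (fun i => dif (tnth fs i))) m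
      = iter_comm fs (@pd C r E k) m.
Proof.
pose F (w : 'I_k -> Omega E) : lhom L (PP E k) :=
  \sum_(J : {ffun 'I_k -> 'I_p})
    (\prod_i (contr (D (J i)) $$ w i : A)) *: symm_fun (fun i => g (J i)).
have Fl : multilinear F.
  move=> w i a u v; rewrite /F scaler_sumr -big_split /=.
  apply: eq_bigr => J _; have P x : \prod_j (contr (D (J j)) $$ upd w i x j : A)
      = contr (D (J i)) $$ x * \prod_(j | j != i) (contr (D (J j)) $$ w j : A).
    rewrite (bigD1 i) //= upd_same; congr (_ * _).
    by apply: eq_bigr => j /negPf ji; rewrite /upd ji.
  by rewrite !P hom_fun_is_linear mulrDl scalerDl scalerA mulrA.
have Fs : symmetric_fun F.
  move=> s w; rewrite /F.
  pose js (J : {ffun 'I_k -> 'I_p}) := [ffun i => J (s i)].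
  rewrite (reindex_inj (h := js)) /=.
    apply: eq_bigr => J _.
    apply: (f_equal2 (fun (a : A) (h : lhom L (PP E k)) => a *: h)).
      rewrite [RHS](reindex_inj (@perm_inj _ s)) /=.
      by apply: eq_bigr => i _; rewrite ffunE.
    rewrite -[RHS](symm_fun_sym s); apply: (congr1 symm_fun).
    by apply/funext => i; rewrite ffunE.
  move=> J J' /ffunP JJ; apply/ffunP => i.
  by have := JJ ((s^-1)%g i); rewrite !ffunE permKV.
pose G := extend (@sym_rel _ k (Omega E)) F.
have GE w : G $$ sprod w = F w by apply: sym_extendE.
have [f fE] : exists f : lhom (tens (sympow k (Omega E)) L) (PP E k),
    forall phi m, f $$ tprod phi m = G $$ phi $$ m.
  apply: (tens_lift (g := fun phi m => G $$ phi $$ m)) => [m a u v|phi].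
    by rewrite hom_fun_is_linear homDE homZE.
  exact: hom_fun_is_linear.
exists f => fs m; rewrite fE GE.
have -> : iter_comm fs (@pd C r E k) m = symm_fun (tnth fs) $$ m.
  by rewrite mkhomE /fseq map_tnth_enum.
congr (_ $$ m); symmetry.
(* Each slot is a derivation, hence factors linearly through [dif x], and the expansion of [dif x]
   along the [dif (g j)] gives the hypothesis. *)
apply: (slot_expand (M := A^o) (c := fun j x => contr (D j) $$ dif x)).
move=> t i x.
have XE := kahler_extendE (symm_fun_slot t i).
rewrite -XE [in LHS](gD (dif x)) linear_sum; apply: eq_bigr => j _.
by rewrite linearZ /= XE.
Qed.

Lemma sym_inclE (fs : k.-tuple A) m :
  sym_incl E k $$ tprod (sprod (fun i => dif (tnth fs i))) m
    = iter_comm fs (@pd C r E k) m.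
Proof. exact: (the_eltP sym_incl_exists). Qed.
End SymIncl.
End Commutators.

(** * Twists by the dual line *)

Section Generic.
Context {A : comNzRingType}.
Implicit Types M N P : lmodType A.

(** Laplace expansion along the first row: [lift_perm] splits a permutation into the image [j] of
    [ord0] and a permutation of the remaining [k] indices. *)
Lemma permanent_expand M N k (b : M -> N -> A^o) (t : 'I_k.+1 -> M) w :
  permanent b t w = \sum_j (b (t ord0) (w j) : A)
    * permanent b (fun i => t (lift ord0 i)) (fun i => w (lift j i)).
Proof.
pose h (q : 'I_k.+1 * 'S_k) := lift_perm ord0 q.1 q.2.
have h_inj : injective h.
  move=> [j s] [j' s'] /permP hE.
  have jj : j = j' by have := hE ord0; rewrite !lift_perm_id.
  congr (_, _) => //; apply/permP => i; have := hE (lift ord0 i).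
  by rewrite !lift_perm_lift -jj => /lift_inj.
have h_bij : bijective h.
  apply: inj_card_bij h_inj _.
  by rewrite card_prod card_Sn card_Sn card_ord factS.
rewrite /permanent (reindex h) /=; last exact: onW_bij.
rewrite (eq_bigr (fun q : 'I_k.+1 * 'S_k => b (t ord0) (w q.1)
    * \prod_i b (t (lift ord0 i)) (w (lift q.1 (q.2 i)))))
  => [|q _]; last first.
  rewrite big_ord_recl lift_perm_id; congr (_ * _).
  by apply: eq_bigr => i _; rewrite lift_perm_lift.
rewrite -(pair_big xpredT xpredT (fun j (s : 'S_k) => b (t ord0) (w j)
    * \prod_i b (t (lift ord0 i)) (w (lift j (s i))))) /=.
by apply: eq_bigr => j _; rewrite mulr_sumr.
Qed.

Lemma tprodZl M N a (m : M) (n : N) : tprod (a *: m) n = a *: tprod m n.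
Proof. exact: (is_linear_Z _ _ (@tprod_linearl _ M N n)). Qed.

Lemma tprodZr M N a (m : M) (n : N) : tprod m (a *: n) = a *: tprod m n.
Proof. exact: (is_linear_Z _ _ (@tprod_linearr _ M N m)). Qed.

Lemma tens_ind M N (P : tens M N -> Prop) : P 0 ->
  (forall a m n x, P x -> P (a *: tprod m n + x)) -> forall x, P x.
Proof.
by move=> P0 Pc; apply: pres_ind => // a [m n] y Py; apply: (Pc a m n).
Qed.

Lemma tens_line M N (e : N) : (forall n, exists a : A, n = a *: e) ->
  forall x : tens M N, exists m, x = tprod m e.
Proof.
move=> Ne; apply: tens_ind => [|a m n _ [m' ->]].
  by exists 0; rewrite (is_linear_0 (@tprod_linearl _ M N e)).
have [c ->] := Ne n; exists ((a * c) *: m + m').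
by rewrite tprod_linearl tprodZr scalerA.
Qed.

(** Preimages under an injective linear map are unique, so any choice of them is linear. This yields
    the maps that are specified only after composition with [untwist] or [symdual]. *)
Lemma factor_inj M N P (u : lhom M N) (h : P -> N) :
  (forall x, u $$ x = 0 -> x = 0) -> is_linear h ->
  (forall D, exists y, u $$ y = h D) ->
  exists f : lhom P M, forall D, u $$ (f $$ D) = h D.
Proof.
move=> ui hl hu; have [f fE] := choice hu.
have fl : is_linear f.
  move=> a x y; apply/subr0_eq/ui.
  by rewrite linearB /= hom_fun_is_linear !fE hl subrr.
by exists (mkhom fl).
Qed.

Lemma hcomp_linearl M N P (f : lhom M N) :
  is_linear (fun g : lhom N P => hcomp g f).
Proof. by move=> a u v; apply: hom_ext. Qed.

Lemma hcompE M N P (g : lhom N P) (f : lhom M N) x :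
  hcomp g f $$ x = g $$ (f $$ x).
Proof. by []. Qed.

End Generic.

(** * Untwisting when L is free of rank one with generator [e] and coordinate [lc] *)

Section Twist.
Context {C : comNzRingType} {r : nat} (E : linsys C r).
Local Notation A := (fring E).
Local Notation L := (bundle E).
Context (e : L) (lc : Ld E).
Context (leE : forall m, m = (lc $$ m : A) *: e) (lc1 : lc $$ e = 1).

Lemma Ld_line (l : Ld E) : exists a : A, l = a *: lc.
Proof.
exists (l $$ e); apply: hom_ext => m.
by rewrite homZE {1}(leE m) linearZ; exact: mulrC.
Qed.

Lemma L_line (m : L) : exists a : A, m = a *: e.
Proof. by exists (lc $$ m). Qed.

Section Untwist.
Context (N : lmodType A).

Lemma untwistE (rho : dual (tens N (Ld E))) (l : Ld E) n :
  untwist N $$ tprod rho l $$ n = rho $$ tprod n l.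
Proof.
suff h : exists f : lhom (tens (dual (tens N (Ld E))) (Ld E)) (dual N),
    forall rho l n, f $$ tprod rho l $$ n = rho $$ tprod n l.
  exact: (the_eltP h).
have cl (rho' : dual (tens N (Ld E))) l' :
    is_linear (fun n' => rho' $$ tprod n' l').
  by move=> a u v; rewrite tprod_linearl hom_fun_is_linear.
have [f fE] : exists f : lhom (tens (dual (tens N (Ld E))) (Ld E)) (dual N),
    forall rho' l', f $$ tprod rho' l' = mkhom (cl rho' l').
  apply: (tens_lift (g := fun rho' l' => mkhom (cl rho' l')))
      => [l' a u v|rho' a u v]; apply: hom_ext => n';
    rewrite homDE homZE !mkhomE.
    by rewrite homDE homZE.
  by rewrite tprod_linearr hom_fun_is_linear.
by exists f => rho' l' n'; rewrite fE.
Qed.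

Lemma untwist_inj x : untwist N $$ x = 0 -> x = 0.
Proof.
have [rho ->] := tens_line Ld_line x => h.
suff -> : rho = 0 by exact: (is_linear_0 (@tprod_linearl _ _ _ lc)).
apply: tens_ext => n l; have [a ->] := Ld_line l.
by rewrite tprodZr linearZ /= -untwistE h hom0E scaler0.
Qed.

Lemma untwist_surj (b : dual N) : exists x, untwist N $$ x = b.
Proof.
(* [l] enters through its coordinate [l $$ e]; then [tprod rho lc] is a preimage because
   [lc $$ e = 1]. *)
have [rho rhoE] : exists rho : dual (tens N (Ld E)),
    forall n (l : Ld E), rho $$ tprod n l = ((b $$ n : A) * (l $$ e)).
  apply: (tens_lift (P := A^o)
    (g := fun n (l : Ld E) => (b $$ n : A) * (l $$ e)))
      => [l a u v|n a u v].
    by rewrite hom_fun_is_linear mulrDl -mulrA.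
  by rewrite homDE homZE mulrDr mulrCA.
exists (tprod rho lc); apply: hom_ext => n.
by rewrite untwistE rhoE lc1 mulr1.
Qed.
End Untwist.

Lemma alpha_dualE k D :
  untwist (ImA E k) $$ (alpha_dual E k $$ D)
  = hcomp D (Defs.incl (him (alpha E k))).
Proof.
suff h : exists f : lhom (dual (PP E k)) (tens (dual (Pk E k)) (Ld E)),
    forall D, untwist (ImA E k) $$ (f $$ D)
      = hcomp D (Defs.incl (him (alpha E k))).
  exact: (the_eltP h).
apply: (@factor_inj _ _ _ _ (untwist (ImA E k))
          (fun D => hcomp D (Defs.incl (him (alpha E k))))).
- exact: untwist_inj.
- exact: hcomp_linearl.
- by move=> D'; exact: untwist_surj.
Qed.

Lemma piRE k B :
  untwist (KerA E k) $$ (piR E k $$ B) = hcomp B (Defs.incl (hker (alpha E k))).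
Proof.
suff h : exists f : lhom (dual 'rV[A]_r.+1) (tens (dual (Rk E k)) (Ld E)),
    forall B, untwist (KerA E k) $$ (f $$ B)
      = hcomp B (Defs.incl (hker (alpha E k))).
  exact: (the_eltP h).
apply: (@factor_inj _ _ _ _ (untwist (KerA E k))
          (fun B => hcomp B (Defs.incl (hker (alpha E k))))).
- exact: untwist_inj.
- exact: hcomp_linearl.
- by move=> D'; exact: untwist_surj.
Qed.

Lemma jP_linear k : is_linear (@jP C r E k).
Proof. by move=> a u v; rewrite /jP linearP hcomp_linearl. Qed.

(** Sections of P_k^* ⊗ L^* factor through [alpha], so they vanish on its kernel, where [piR]
    restricts them. *)
Lemma piR_jP k B : piR E k $$ (@jP C r E k B) = 0.
Proof.
apply: untwist_inj; rewrite piRE; apply: hom_ext => t.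
rewrite !hcompE (_ : corestr _ $$ _ = 0) ?linear0 //.
apply: sub_ext; exact: (sub_valP t).
Qed.

Lemma vf_derivation (d : Tan E) : @is_derivation C r E (vf_fun d).
Proof. exact: (sub_valP d). Qed.

(* By [piR_jP] the last term dies in the differential of the Gauss map, which is
   therefore A-linear in B. *)
Lemma vact_leibniz d a (B B' : dual 'rV[A]_r.+1) :
  vact d (a *: B + B') = a *: vact d B + vact d B' + (vf_fun d a : A) *: B.
Proof.
have [hD hM _] := vf_derivation d.
apply: hom_ext => t; rewrite !homDE !homZE.
have -> : B $$ t = \sum_i t ord0 i *: (B $$ delta_mx ord0 i).
  rewrite {1}(row_sum_delta t) linear_sum.
  by apply: eq_bigr => i _; rewrite linearZ.
rewrite -![vact _ _ $$ t]/(vact_fun _ _ t) /vact_fun !scaler_sumr -!big_split.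
apply: eq_bigr => i _; rewrite homDE homZE hD hM.
set x := t ord0 i; set y := B $$ _; set z := vf_fun d (B' $$ _).
rewrite -[LHS]/((x : A) * (a * vf_fun d y + y * vf_fun d a + z)).
rewrite -[RHS]/((a * (x * vf_fun d y) + x * z + vf_fun d a * (x * y)) : A).
by ring.
Qed.

Lemma dgaussE k d B : dgauss E k $$ d $$ B = piR E k $$ vact d (@jP C r E k B).
Proof.
suff h : exists f : lhom (Tan E)
      (lhom (tens (dual (Pk E k)) (Ld E)) (tens (dual (Rk E k)) (Ld E))),
    forall d B, f $$ d $$ B = piR E k $$ vact d (@jP C r E k B).
  exact: (the_eltP h).
have Bl d' : is_linear (fun B' => piR E k $$ vact d' (@jP C r E k B')).
  move=> a u v; rewrite jP_linear vact_leibniz.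
  by rewrite homD hom_fun_is_linear homZ piR_jP scaler0 addr0.
have dl : is_linear (fun d' => mkhom (Bl d')).
  move=> a u v; apply: hom_ext => B'; rewrite homDE homZE !mkhomE.
  rewrite -hom_fun_is_linear; congr hom_fun; apply: hom_ext => t.
  rewrite homDE homZE /= /vact_fun scaler_sumr -big_split /=.
  by apply: eq_bigr => i _; rewrite vf_funP mulrDr mulrCA.
by exists (mkhom dl).
Qed.

End Twist.

(** * Symbols *)

Section Symbols.
Context {C : comNzRingType} {r : nat} (E : linsys C r).
Local Notation A := (fring E).
Local Notation L := (bundle E).
Local Notation SO k := (sympow k (Omega E)).
Local Notation ST k := (sympow k (Tan E)).

Lemma symdualE k theta (l : Ld E) phi (m : L) :
  symdual E k $$ tprod theta l $$ tprod phi m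
    = ((sym_pairing E k $$ theta $$ phi : A) * (l $$ m) : A^o).
Proof.
suff h : exists f : lhom (tens (ST k) (Ld E)) (dual (tens (SO k) L)),
    forall theta (l : Ld E) phi (m : L), f $$ tprod theta l $$ tprod phi m
      = ((sym_pairing E k $$ theta $$ phi : A) * (l $$ m) : A^o).
  exact: (the_eltP h).
have inner theta' (l' : Ld E) : exists G : dual (tens (SO k) L), forall phi m,
    G $$ tprod phi m
    = ((sym_pairing E k $$ theta' $$ phi : A) * (l' $$ m) : A^o).
  apply: (tens_lift (P := A^o)
    (g := fun phi m => (sym_pairing E k $$ theta' $$ phi : A) * (l' $$ m))).
    by move=> m' a u v; rewrite hom_fun_is_linear mulrDl -mulrA.
  by move=> phi' a u v; rewrite hom_fun_is_linear mulrDr mulrCA.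
pose G theta' l' := sval (cid (inner theta' l')).
have GE theta' l' phi' m' : G theta' l' $$ tprod phi' m'
    = (sym_pairing E k $$ theta' $$ phi' : A) * (l' $$ m').
  by rewrite /G; case: cid.
have [f fE] : exists f : lhom (tens (ST k) (Ld E)) (dual (tens (SO k) L)),
    forall theta' l', f $$ tprod theta' l' = G theta' l'.
  apply: tens_lift => [l' a u v|theta' a u v]; apply: tens_ext => phi' m'.
    by rewrite homDE homZE !GE hom_fun_is_linear homDE homZE mulrDl -mulrA.
  by rewrite homDE homZE !GE homDE homZE mulrDr mulrCA.
by exists f => theta' l' phi' m'; rewrite fE GE.
Qed.

Lemma fseqS k S (t : 'I_k.+1 -> S) :
  fseq t = t ord0 :: fseq (fun i => t (lift ord0 i)).
Proof. by rewrite /fseq enum_ordSl /= -map_comp. Qed.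

Lemma vf_funB (d : Tan E) (x y : A) :
  vf_fun d (x - y) = vf_fun d x - vf_fun d y.
Proof.
have [hD _ _] := dif_derivation E; rewrite -!contrE.
have -> : dif (x - y) = dif x - dif y.
  by apply/eqP; rewrite eq_sym subr_eq -hD subrK.
exact: linearB.
Qed.

Lemma vf_fun0 (d : Tan E) : vf_fun d 0 = 0.
Proof. by have := vf_funB d 0 0; rewrite !subrr. Qed.

Lemma vf_funZ (d : Tan E) (a : A) (x : A^o) :
  vf_fun d (a *: x) = a *: vf_fun d x + (vf_fun d a : A) *: x.
Proof.
by have [_ hM _] := vf_derivation d; rewrite [LHS]hM [X in _ + X]mulrC.
Qed.

(* [d o P, f] = d o [P, f] + d(f) P, iterated. *)
Lemma iter_comm_vf (d : Tan E) (P : L -> A^o) k (t : 'I_k.+1 -> A) m :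
  iter_comm (fseq t) (fun m => vf_fun d (P m)) m
  = vf_fun d (iter_comm (fseq t) P m)
    + \sum_j (vf_fun d (t j) : A)
        *: iter_comm (fseq (fun i => t (lift j i))) P m.
Proof.
elim: k t m => [|k IH] t m.
  rewrite big_ord1 !fseqS /fseq enum_ord0 /= vf_funB vf_funZ.
  by rewrite opprD addrA subrK.
rewrite fseqS iter_comm_cons !IH [in RHS]iter_comm_cons vf_funB vf_funZ.
(* The term [j = ord0] cancels the Leibniz term in which [d] differentiates the coefficient
   [t ord0]. *)
rewrite [in RHS]big_ord_recl [in RHS]opprD ![in RHS]addrA subrK.
rewrite scalerDr opprD addrACA; congr (_ + _).
rewrite scaler_sumr -sumrB.
apply: eq_bigr => j _; rewrite [in RHS]fseqS iter_comm_cons.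
(* Omitting a later slot keeps slot [ord0] in front, so its commutator can be split off. *)
have -> : lift (lift ord0 j) ord0 = ord0 :> 'I_k.+2 by apply: val_inj.
have -> : (fun i => t (lift (lift ord0 j) (lift ord0 i)))
    = (fun i => t (lift ord0 (lift j i))).
  apply/funext => i; congr t; apply: val_inj.
  by rewrite /= /bump !leq0n !add1n ltnS addnS.
by rewrite scalerBr !scalerA [t ord0 * _]mulrC.
Qed.
End Symbols.

(** The condition on [h] refers to its arguments only through [p], so it contains both linearity and
    independence of the chosen preimage. *)
Lemma factor_surj (A : comNzRingType) (M N P : lmodType A) (p : lhom P M)
    (h : P -> N) :
  (forall x, exists y, p $$ y = x) ->
  (forall a u v w, p $$ w = a *: (p $$ u) + p $$ v -> h w = a *: h u + h v) ->
  exists f : lhom M N, forall y, f $$ (p $$ y) = h y.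
Proof.
move=> /choice[q qE] hl; pose f x := h (q x).
have fl : is_linear f by move=> a u v; apply: hl; rewrite !qE.
exists (mkhom fl) => y; rewrite mkhomE /f.
have h0 : h 0 = 0.
  have := hl (-1) 0 0 0; rewrite !scaleN1r !addNr (linear0 (hom_fun p)).
  exact.
have := hl 1 y 0 (q (p $$ y)).
by rewrite h0 (linear0 (hom_fun p)) qE !scale1r !addr0; exact.
Qed.

(** * Perfect duality of symmetric powers, and symbols of operators *)

Section PrincipalSymbol.
Context {C : comNzRingType} {r : nat} (E : linsys C r).
Local Notation A := (fring E).
Local Notation L := (bundle E).
Local Notation SO k := (sympow k (Omega E)).
Local Notation ST k := (sympow k (Tan E)).
Context (e : L) (lc : Ld E).
Context (leE : forall m, m = (lc $$ m : A) *: e) (lc1 : lc $$ e = 1).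
Context (p : nat) (g : 'I_p -> A) (D : 'I_p -> Tan E).
Context (gD : exact_dual_basis g D).
Context (facU : forall k, exists u : A, u * k`!%:R = 1).

Lemma fact_cancel k (M : lmodType A) (x : M) : k`!%:R *: x = 0 -> x = 0.
Proof.
move=> x0; have [u uk] := facU k.
by rewrite -[x]scale1r -uk -scalerA x0 scaler0.
Qed.

Lemma sym_pairing_injl k (theta : ST k) :
  (forall phi, sym_pairing E k $$ theta $$ phi = 0) -> theta = 0.
Proof.
move=> h; apply: (@fact_cancel k); rewrite (casimir_tan gD) big1 // => J _.
by rewrite h scale0r.
Qed.

Lemma sym_pairing_injr k (phi : SO k) :
  (forall t, sym_pairing E k $$ sprod t $$ phi = 0) -> phi = 0.
Proof.
move=> h; apply: (@fact_cancel k); rewrite (casimir_omega gD) big1 // => J _.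
by rewrite h scale0r.
Qed.

Lemma sym_pairing_surj k (b : dual (SO k)) :
  exists theta, sym_pairing E k $$ theta = b.
Proof.
have [u uk] := facU k.
(* The Casimir formula for [theta], with the pairing replaced by the values of [b] and divided by
   [k!]. *)
exists (u *: \sum_(J : {ffun 'I_k -> 'I_p})
  (b $$ sprod (fun i => dif (g (J i))) : A) *: sprod (fun i => D (J i))).
apply: hom_ext => phi; rewrite homZ homZE hom_sum hom_sumE.
transitivity (u *: (b $$ (k`!%:R *: phi))); last first.
  by rewrite -homZ scalerA uk scale1r.
congr (_ *: _); rewrite (casimir_omega gD phi) hom_sum.
by apply: eq_bigr => J _; rewrite homZ homZE homZ; exact: mulrC.
Qed.

(** By [casimir_omega], [k!] times any symmetric form is a combination of products of exact
    differentials. *)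
Lemma SO_ext k (N : lmodType A) (f f' : lhom (SO k) N) :
  (forall s : 'I_k -> A, f $$ sprod (fun i => dif (s i))
     = f' $$ sprod (fun i => dif (s i))) -> f = f'.
Proof.
move=> ff; apply: hom_ext => phi; apply/subr0_eq/(@fact_cancel k).
rewrite scalerBr -!homZ (casimir_omega gD phi) !hom_sum -sumrB big1 // => J _.
by rewrite !homZ (ff (fun i => g (J i))) subrr.
Qed.

Lemma SOL_ext k (N : lmodType A) (f f' : lhom (tens (SO k) L) N) :
  (forall (s : 'I_k -> A) m, f $$ tprod (sprod (fun i => dif (s i))) m
     = f' $$ tprod (sprod (fun i => dif (s i))) m) -> f = f'.
Proof.
move=> ff; apply: tens_ext => phi m.
pose T := mkhom (@tprod_linearl _ (SO k) L m).
rewrite -[LHS]/(hcomp f T $$ phi) -[RHS]/(hcomp f' T $$ phi); congr hom_fun.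
by apply: SO_ext => s; rewrite !hcompE ff.
Qed.

Lemma symdual_inj k x : symdual E k $$ x = 0 -> x = 0.
Proof.
have [theta ->] := tens_line (Ld_line leE) x => h.
suff -> : theta = 0 by exact: (is_linear_0 (@tprod_linearl _ _ _ lc)).
apply: sym_pairing_injl => phi.
by rewrite -[LHS]mulr1 -lc1 -symdualE h.
Qed.

Lemma symdual_surj k (b : dual (tens (SO k) L)) :
  exists x, symdual E k $$ x = b.
Proof.
pose T := mkhom (@tprod_linearl _ (SO k) L e).
have [theta thetaE] := sym_pairing_surj (hcomp b T).
exists (tprod theta lc); apply: tens_ext => phi m.
by rewrite symdualE thetaE [in RHS](leE m) tprodZr homZ; exact: mulrC.
Qed.

Lemma pr_symE k X : symdual E k $$ (pr_sym E k $$ X) = hcomp X (sym_incl E k).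
Proof.
suff h : exists f : lhom (dual (PP E k)) (tens (ST k) (Ld E)),
    forall X, symdual E k $$ (f $$ X) = hcomp X (sym_incl E k).
  exact: (the_eltP h).
apply: (@factor_inj _ _ _ _ (symdual E k) (fun X => hcomp X (sym_incl E k))).
- exact: symdual_inj.
- exact: hcomp_linearl.
- by move=> X'; exact: symdual_surj.
Qed.

Lemma sym_incl_fseq k (s : 'I_k -> A) m :
  sym_incl E k $$ tprod (sprod (fun i => dif (s i))) m
    = iter_comm (fseq s) (@pd C r E k) m.
Proof.
have := sym_inclE gD (mktuple s) m.
rewrite (_ : (fun i => _) = (fun i => dif (s i))) => [->|]; last first.
  by apply/funext => i; rewrite tnth_mktuple.
by congr (iter_comm _ _ _); rewrite /= val_ord_tuple.
Qed.

(** The principal symbol, computed as a [k]-fold commutator. *)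
Lemma pr_sym_eval k X (s : 'I_k -> A) m :
  symdual E k $$ (pr_sym E k $$ X) $$ tprod (sprod (fun i => dif (s i))) m
    = X $$ iter_comm (fseq s) (@pd C r E k) m.
Proof. by rewrite pr_symE hcompE sym_incl_fseq. Qed.

Lemma symdual_ext k x y :
  (forall (s : 'I_k -> A) m,
     symdual E k $$ x $$ tprod (sprod (fun i => dif (s i))) m
     = symdual E k $$ y $$ tprod (sprod (fun i => dif (s i))) m) -> x = y.
Proof.
move=> xy; apply/subr0_eq/symdual_inj; rewrite homB.
by apply/eqP; rewrite subr_eq0; apply/eqP/SOL_ext.
Qed.

(** By [iter_comm_vf], every term of a (k+2)-fold commutator of the composite contains at least k+1
    commutators of an operator of order [k]. *)
Lemma vcomp_diffop k (d : Tan E) (X : dual (PP E k)) :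
  diffop k.+1 (fun m : L => vf_fun d (X $$ pd k m)).
Proof.
have [hD hM hC] := vf_derivation d; have [[XD XC] XI] := hom_diffop X.
split; first split=> [u v|c m].
- by rewrite XD hD.
- by rewrite XC vf_funZ hC scale0r addr0.
- move=> fs /eqP sz m; pose T := Tuple sz.
  have -> : fs = fseq (tnth T) by rewrite /fseq map_tnth_enum.
  rewrite (iter_comm_vf d (fun m => X $$ pd k m)) big1 => [|j _].
    rewrite addr0 fseqS iter_comm_cons !XI ?size_fseq // scaler0 subr0.
    by rewrite vf_fun0.
  by rewrite XI ?size_fseq // scaler0.
Qed.

Lemma vcompE k (d : Tan E) (X : dual (PP E k)) m :
  vcomp (k := k.+1) d X $$ pd k.+1 m = vf_fun d (X $$ pd k m).
Proof.
suff h : exists X' : dual (PP E k.+1),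
    forall m, X' $$ pd k.+1 m = vf_fun d (X $$ pd k m) by exact: (the_eltP h).
exact: PP_lift (vcomp_diffop d X).
Qed.

Lemma pr_vcomp_eval k (d : Tan E) X (s : 'I_k.+1 -> A) m :
  symdual E k.+1 $$ (pr_sym E k.+1 $$ vcomp (k := k.+1) d X)
      $$ tprod (sprod (fun i => dif (s i))) m
  = \sum_j (vf_fun d (s j) : A) *: (symdual E k $$ (pr_sym E k $$ X)
      $$ tprod (sprod (fun i => dif (s (lift j i)))) m).
Proof.
rewrite pr_sym_eval iter_comm_hom.
rewrite (_ : (fun m => _) = (fun m => vf_fun d (X $$ pd k m))); last first.
  by apply/funext => m'; rewrite vcompE.
rewrite iter_comm_vf -iter_comm_hom.
(* Where [d] stays outermost there are [k.+1] commutators of an operator of order [k]; only the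
   terms with [d] applied to some [s j] survive. *)
have -> : iter_comm (fseq s) (@pd C r E k) m = 0.
  by have [_ ->] := @pd_diffop C r E k; rewrite ?size_fseq.
rewrite (linear0 (hom_fun X)) vf_fun0 add0r; apply: eq_bigr => j _.
by rewrite (pr_sym_eval X) iter_comm_hom.
Qed.
End PrincipalSymbol.

(** * The fundamental form and the Gauss map *)

Section Correspondence.
Context {C : comNzRingType} {r : nat} (E : linsys C r).
Local Notation A := (fring E).
Local Notation L := (bundle E).
Local Notation SO k := (sympow k (Omega E)).
Local Notation ST k := (sympow k (Tan E)).
Context (e : L) (lc : Ld E).
Context (leE : forall m, m = (lc $$ m : A) *: e) (lc1 : lc $$ e = 1).
Context (p : nat) (g : 'I_p -> A) (D : 'I_p -> Tan E).
Context (gD : exact_dual_basis g D).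
Context (facU : forall k, exists u : A, u * k`!%:R = 1).

Let pr_eval := pr_sym_eval leE lc1 gD facU.
Let pr_eq := symdual_ext leE lc1 gD facU.
Let pr_vcomp := pr_vcomp_eval leE lc1 gD facU.

(** The sum in [pr_vcomp_eval] is the expansion of the permanent along its first row, so composing
    with a vector field multiplies the symbol by it. *)
Lemma pr_sym_vcomp k (t : 'I_k.+1 -> Tan E) l X :
  pr_sym E k $$ X = tprod (sprod (fun i => t (lift ord0 i))) l ->
  pr_sym E k.+1 $$ vcomp (k := k.+1) (t ord0) X = tprod (sprod t) l.
Proof.
move=> XE; apply: pr_eq => s m; rewrite pr_vcomp symdualE sym_pairingE.
rewrite /contr_perm permanent_expand mulr_suml; apply: eq_bigr => j _.
by rewrite XE symdualE sym_pairingE contrE -mulrA.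
Qed.

(** The operator is the composite of all [t i] after [l]; the induction starts from [l] as an
    operator of order 0. *)
Lemma pr_sym_sprod k (t : 'I_k -> Tan E) l :
  exists X, pr_sym E k $$ X = tprod (sprod t) l.
Proof.
elim: k t => [|k IH] t; last first.
  have [X XE] := IH (fun i => t (lift ord0 i)).
  by eexists; exact: pr_sym_vcomp XE.
have dl : @diffop C r E 0 _ (hom_fun l).
  split; first split=> [u v|c m]; rewrite ?homD ?homZ //.
  by case=> [|f [|]] // _ m; rewrite /= homZ subrr.
have [X XE] := PP_lift dl; exists X; apply: pr_eq => s m.
rewrite pr_eval symdualE sym_pairingE /fseq enum_ord0 /= XE.
rewrite /contr_perm /permanent (big_pred1 1%g) => [|s'].
  by rewrite big_ord0 mul1r.
by apply/esym/eqP/permP => -[].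
Qed.

Lemma pr_sym_surj k x : exists X, pr_sym E k $$ X = x.
Proof.
have [theta ->] := tens_line (Ld_line leE) x.
move: theta; apply: (@pres_ind _ _ (@sym_rel _ k (Tan E)))
  => [|a t theta [X XE]].
  by exists 0; rewrite (is_linear_0 (@tprod_linearl _ _ _ lc)) linear0.
have [Y YE] := pr_sym_sprod t lc; exists (a *: Y + X).
by rewrite hom_fun_is_linear XE YE tprod_linearl.
Qed.

(** The induced map exists because [pr_sym] is onto and, by [pr_vcomp_eval], the symbol of the
    composite depends only on the symbol of [X]. *)
Lemma vsymE k (d : Tan E) X : vsym k.+1 d $$ (pr_sym E k $$ X)
  = pr_sym E k.+1 $$ vcomp (k := k.+1) d X.
Proof.
suff h : exists f : lhom (tens (ST k) (Ld E)) (tens (ST k.+1) (Ld E)),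
    forall X, f $$ (pr_sym E k $$ X) = pr_sym E k.+1 $$ vcomp (k := k.+1) d X.
  exact: (the_eltP h).
apply: (factor_surj (p := pr_sym E k)
    (h := fun X => pr_sym E k.+1 $$ vcomp (k := k.+1) d X)) => [|a u v w wE].
  exact: pr_sym_surj.
apply: pr_eq => s m; rewrite hom_fun_is_linear homDE homZE !pr_vcomp.
rewrite scaler_sumr -big_split; apply: eq_bigr => j _.
rewrite wE hom_fun_is_linear homDE homZE scalerDr !scalerA.
by rewrite [a * _]mulrC.
Qed.

(** Each product of vector fields, twisted by [lc], is the symbol of some operator, and pairing with
    it is evaluating that operator on the image in P^k(L). *)
Lemma sym_incl_inj k x : sym_incl E k $$ x = 0 -> x = 0.
Proof.
have [phi ->] := tens_line (L_line leE) x => h.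
suff -> : phi = 0 by exact: (is_linear_0 (@tprod_linearl _ _ _ e)).
apply: (sym_pairing_injr gD facU) => t; have [X XE] := pr_sym_sprod t lc.
rewrite -[LHS]mulr1 -lc1 -symdualE -XE (pr_symE leE lc1 gD facU) hcompE h.
by rewrite linear0.
Qed.

(** Of the relations defining P^k(L), only the (k+1)-fold commutators can be nonzero in P^(k+1)(L),
    and these are images of products of exact differentials. *)
Lemma sym_incl_kernel k (u : free_mod L) : gspan (@pp_rel C r E k) u ->
  exists x, sym_incl E k.+1 $$ x = projh (span_mod (@pp_rel C r E k.+1)) $$ u.
Proof.
elim=> [|a v w Gv _ [x xE]]; first by exists 0; rewrite !linear0.
suff [y yE] : exists y,
    sym_incl E k.+1 $$ y = projh (span_mod (@pp_rel C r E k.+1)) $$ v.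
  by exists (a *: y + x); rewrite !hom_fun_is_linear xE yE.
case: Gv => [m m'|c m|fs m /eqP sz].
- by exists 0; rewrite linear0 (pres_rel (@pp_add C r E k.+1 m m')).
- by exists 0; rewrite linear0 (pres_rel (@pp_scale C r E k.+1 c m)).
- exists (tprod (sprod (fun i => dif (tnth (Tuple sz) i))) m).
  by rewrite (sym_inclE gD) iter_comm_hom.
Qed.

Lemma alpha_kernel k (t : KerA E k) :
  exists phi, sym_incl E k.+1 $$ tprod phi e = alpha E k.+1 $$ sub_val t.
Proof.
(* One lift of the Taylor series to the free module serves all orders; vanishing at order [k] puts
   it in the span of the relations of that order. *)
pose u : free_mod L := \sum_i (sub_val t) ord0 i *: fgen (sect E i).
have uE j : alpha E j $$ sub_val t = projh (span_mod (@pp_rel C r E j)) $$ u.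
  by rewrite hom_sum; apply: eq_bigr => i _; rewrite homZ.
have : gspan (@pp_rel C r E k) u.
  rewrite -[u]subr0; apply/(proj_eq (span_mod (@pp_rel C r E k))).
  rewrite -[LHS]/(projh _ $$ u) -uE (sub_valP t).
  by rewrite -[RHS]/(projh _ $$ 0) linear0.
move=> /sym_incl_kernel[x xE]; rewrite uE -xE.
by have [phi ->] := tens_line (L_line leE) x; exists phi.
Qed.

Lemma fundformE k (t : KerA E k) (l : Ld E) (m : L) :
  sym_incl E k.+1 $$ tprod (fundform E k.+1 $$ tprod t l) m
  = (l $$ m : A) *: (alpha E k.+1 $$ sub_val t).
Proof.
suff h : exists F : lhom (Rk E k) (SO k.+1),
    forall (t : KerA E k) (l : Ld E) (m : L),
    sym_incl E k.+1 $$ tprod (F $$ tprod t l) m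
    = (l $$ m : A) *: (alpha E k.+1 $$ sub_val t).
  exact: (the_eltP h).
pose T := mkhom (@tprod_linearl _ (SO k.+1) L e).
have [F FE] : exists F : lhom (KerA E k) (SO k.+1), forall t,
    hcomp (sym_incl E k.+1) T $$ (F $$ t) = alpha E k.+1 $$ sub_val t.
  apply: (@factor_inj _ _ _ _ (hcomp (sym_incl E k.+1) T)
           (fun t => alpha E k.+1 $$ sub_val t)).
  - move=> phi /sym_incl_inj h; apply: (sym_pairing_injr gD facU) => t'.
    by rewrite -[LHS]mulr1 -lc1 -symdualE -[X in _ $$ X]/(T $$ phi) h linear0.
  - by move=> a u v; rewrite subDE subZE hom_fun_is_linear.
  - exact: alpha_kernel.
(* [F] is the form trivialized by [e]; the factor [l $$ e], the coordinate of [l] along [lc],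
   restores the twist. *)
have [G GE] : exists G : lhom (Rk E k) (SO k.+1), forall t' (l' : Ld E),
    G $$ tprod t' l' = (l' $$ e : A) *: (F $$ t').
  apply: (tens_lift (g := fun t' (l' : Ld E) => (l' $$ e : A) *: (F $$ t'))).
    by move=> l' a u v; rewrite hom_fun_is_linear scalerDr !scalerA mulrC.
  by move=> t' a u v; rewrite homDE homZE scalerDl -scalerA.
exists G => t' l' m'; rewrite GE -FE hcompE [in LHS](leE m') [in RHS](leE m').
rewrite tprodZl tprodZr !homZ scalerA; congr (_ *: _); exact: mulrC.
Qed.

Lemma fdualE k (G : lhom (Rk E k) (SO k.+1)) theta :
  fdual (k := k.+1) G $$ theta = hcomp (sym_pairing E k.+1 $$ theta) G.
Proof.
suff h : exists F : lhom (ST k.+1) (dual (Rk E k)),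
    forall theta, F $$ theta = hcomp (sym_pairing E k.+1 $$ theta) G.
  exact: (the_eltP h).
have hl : is_linear (fun theta' => hcomp (sym_pairing E k.+1 $$ theta') G).
  by move=> a u v; rewrite hom_fun_is_linear hcomp_linearl.
by exists (mkhom hl).
Qed.

Lemma untwist_ftwist k (G : lhom (Rk E k) (SO k.+1)) theta l t :
  untwist (KerA E k) $$ (ftwist (k := k.+1) G $$ tprod theta l) $$ t
  = sym_pairing E k.+1 $$ theta $$ (G $$ tprod t l).
Proof.
rewrite /ftwist.
rewrite (tens_extendE (g := fun x y => tprod (fdual (k := k.+1) G $$ x) y)).
- by rewrite untwistE fdualE.
- by move=> l' a u v; rewrite hom_fun_is_linear tprod_linearl.
- by move=> theta'; exact: tprod_linearr.
Qed.

(** Both sides are the value of [Y] on the image of F^*_k under [sym_incl]; symbols are thereby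
    traded for operators. *)
Lemma untwist_ftwist_fundform k (Y : dual (PP E k.+1)) t :
  untwist (KerA E k) $$ (ftwist (fundform E k.+1) $$ (pr_sym E k.+1 $$ Y)) $$ t
  = Y $$ (alpha E k.+1 $$ sub_val t).
Proof.
have [theta YE] := tens_line (Ld_line leE) (pr_sym E k.+1 $$ Y).
rewrite YE untwist_ftwist -[LHS]mulr1 -lc1 -symdualE -YE.
by rewrite (pr_symE leE lc1 gD facU) hcompE fundformE lc1 scale1r.
Qed.

Lemma dgauss_alpha_dual k (d : Tan E) X :
  dgauss E k $$ d $$ (alpha_dual E k $$ X)
  = ftwist (fundform E k.+1) $$ (pr_sym E k.+1 $$ vcomp (k := k.+1) d X).
Proof.
apply/subr0_eq/(untwist_inj leE); rewrite homB.
apply/eqP; rewrite subr_eq0; apply/eqP/hom_ext => t.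
rewrite (dgaussE leE lc1) (piRE leE lc1) hcompE.
rewrite (untwist_ftwist_fundform (vcomp (k := k.+1) d X)).
rewrite -[vact _ _ $$ _]/(vact_fun _ _ _) /vact_fun.
rewrite -[alpha E k.+1 $$ _]/(taylor_fun _ _) /taylor_fun hom_sum.
(* Term by term, [d] differentiates the value of [X] on the Taylor series of [sect E i], never the
   coefficients of [t]. *)
apply: eq_bigr => i _; rewrite homZ vcompE /jP (alpha_dualE leE lc1).
have <- : alpha E k $$ delta_mx ord0 i = pd k (sect E i).
  rewrite -[LHS]/(taylor_fun _ _) /taylor_fun (bigD1 i) //= mxE !eqxx scale1r.
  by rewrite big1 ?addr0 // => j /negPf ji; rewrite mxE ji andbF scale0r.
by [].
Qed.

Lemma fundform_corresponds k : corresponds (fundform E k.+1) (dgauss E k).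
Proof.
by move=> d X; rewrite /ftwist_at hcompE vsymE; exact: dgauss_alpha_dual.
Qed.

(** To test against a product of k+1 vector fields, the last [k] are realized as the symbol of an
    operator and the first serves as the argument of [delta]. *)
Lemma corresponds_uniq k (G G' : lhom (Rk E k) (SO k.+1)) delta :
  corresponds (k := k.+1) G delta -> corresponds (k := k.+1) G' delta -> G = G'.
Proof.
move=> hG hG'; apply: tens_ext => t l; have [a ->] := Ld_line leE l.
rewrite tprodZr !homZ; congr (_ *: _).
apply/subr0_eq/(sym_pairing_injr gD facU) => q; rewrite homB.
have [X XE] := pr_sym_sprod (fun i => q (lift ord0 i)) lc.
have := etrans (esym (hG (q ord0) X)) (hG' (q ord0) X).
rewrite /ftwist_at !hcompE vsymE (pr_sym_vcomp XE) => /(congr1 (fun x =>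
  untwist (KerA E k) $$ x $$ t)).
by rewrite !untwist_ftwist => ->; rewrite subrr.
Qed.

(* A free cokernel makes the image a direct summand, so functionals extend. *)
Lemma alpha_dual_surj k c : free_of_rank (CokerA E k) c ->
  forall B, exists X, alpha_dual E k $$ X = B.
Proof.
move=> [q /basis_coord[z zE]] B.
have [x xE] := choice (fun j => projP (q j)).
pose b := untwist (ImA E k) $$ B.
(* The projection onto the image along lifts of a basis of the cokernel; [b] composed with it is the
   extension. *)
pose y w := w - \sum_j (z j $$ proj (him (alpha E k)) w : A) *: x j.
have yl : is_linear y.
  move=> a u v; rewrite /y proj_is_linear scalerBr addrACA -opprD.
  congr (_ - _); rewrite scaler_sumr -big_split; apply: eq_bigr => j _.
  by rewrite hom_fun_is_linear scalerDl scalerA.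
have yI w : him (alpha E k) (y w).
  rewrite -[y w]subr0; apply/(proj_eq (him (alpha E k))).
  rewrite -[LHS]/(projh _ $$ _) -[RHS]/(projh _ $$ _) linear0 homB hom_sum.
  rewrite [X in X - _]zE; apply/eqP; rewrite subr_eq0; apply/eqP/eq_bigr => j _.
  by rewrite homZ xE.
have Xl : is_linear (fun w => b $$ mksub (yI w)).
  move=> a u v; rewrite -hom_fun_is_linear; congr hom_fun.
  by apply: sub_ext; exact: yl.
exists (mkhom Xl); apply/subr0_eq/(untwist_inj leE); rewrite homB.
apply/eqP; rewrite subr_eq0 (alpha_dualE leE lc1); apply/eqP/hom_ext => w.
rewrite hcompE mkhomE; congr hom_fun; apply: sub_ext.
rewrite -[LHS]/(y (sub_val w)) /y big1 ?subr0 // => j _.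
rewrite (_ : proj _ _ = 0) ?linear0 ?scale0r //.
rewrite -(linear0 (hom_fun (projh (him (alpha E k))))).
by apply/(proj_eq (him (alpha E k))); rewrite subr0; exact: sub_valP.
Qed.

End Correspondence.

(** * Stalks *)

Section StalkTwist.
Context {R : realType} {r : nat} (X : set (coords R r)) (x : X).
Local Notation C := (complex R).

Lemma germM (f g : coords R r -> C) : germ x (f * g) = germ x f * germ x g.
Proof. by rewrite /germ !piE. Qed.

Lemma stalk_factorial k : exists u : fring (stalk x), u * k`!%:R = 1.
Proof.
exists (const (stalk x) (k`!%:R^-1)).
rewrite -(rmorph_nat (const (stalk x))) -rmorphM mulVf ?rmorph1 //.
by rewrite Num.Theory.pnatr_eq0 -lt0n fact_gt0.
Qed.

Lemma quasi_projective_neq0 : quasi_projective X -> exists i, val x i != 0.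
Proof.
move=> [S [S' XE]]; have : X (val x) by exact: set_valP.
rewrite {1}XE => -[[x0 _] _]; apply/existsP; apply: contra_notT x0.
rewrite negb_exists => /forallP x0; apply/funext => i.
by apply/eqP; rewrite -[_ == _]negbK.
Qed.

(** * Trivialization of O_X(1) by a nonvanishing coordinate *)

Section Coordinate.
Context (i : 'I_r.+1) (xi : val x i != 0).

(** This has degree -1, whereas [reg_germ] is indexed by natural numbers, so it is taken among germs
    of arbitrary functions. *)
Let inv_germ : germs x := germ x (fun y => (y i)^-1).

Lemma near_coord_neq0 : near_in X (val x) (fun y => y i != 0).
Proof.
exists 'X_i, 1%N; split => [||y _]; rewrite ?mevalXU //.
- by rewrite dhomogX /= mdeg1.
- exact/eqP.
- by move/eqP.
Qed.

Lemma coord_inv_germ : germ x (fun y => y i) * inv_germ = 1.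
Proof.
rewrite -germM -germ1; apply/germE; apply: near_inW near_coord_neq0 => y yi.
exact: mulfV.
Qed.

Lemma reg_germ_div (m : germs x) :
  m \in reg_germ x 1 -> m * inv_germ \in reg_germ x 0.
Proof.
move=> /asboolP[f [-> [p [q [d [hp hq nf]]]]]]; apply/asboolP.
exists (f * (fun y => (y i)^-1)); split; first by rewrite germM.
(* The factor ['X_i] raises the degree of the denominator to that of [p]. *)
exists p, (q * 'X_i), (d + 1)%N; split.
- by rewrite addn0.
- by apply: dhomogM => //; rewrite dhomogX /= mdeg1.
apply: near_inW (near_inI near_coord_neq0 nf) => y [yi [/eqP qy fE]].
rewrite mevalM mevalXU; split; first by apply/eqP; rewrite mulf_neq0.
by rewrite -[LHS]/(f y * (y i)^-1) fE invfM mulrA.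
Qed.

Lemma stalk_L_reg (m : bundle (stalk x)) : sub_val m \in reg_germ x 1.
Proof. exact: (sub_valP m). Qed.

Definition coord_quot (m : bundle (stalk x)) : fring (stalk x) :=
  exist _ (sub_val m * inv_germ : germs x) (reg_germ_div (stalk_L_reg m)).

Lemma coord_quot_is_linear : is_linear (coord_quot : _ -> (fring (stalk x))^o).
Proof.
move=> a u v; apply: val_inj.
rewrite -[LHS]/((val a * sub_val u + sub_val v) * inv_germ).
rewrite -[RHS]/(val a * (sub_val u * inv_germ) + sub_val v * inv_germ).
by rewrite mulrDl mulrA.
Qed.

Lemma coord_quotK (m : bundle (stalk x)) :
  m = (mkhom coord_quot_is_linear $$ m : fring (stalk x)) *: (sect (stalk x) i).
Proof.
apply: sub_ext; rewrite -[RHS]/(sub_val m * inv_germ * germ x (fun y => y i)).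
by rewrite -mulrA [inv_germ * _]mulrC coord_inv_germ mulr1.
Qed.

Lemma coord_quot1 : mkhom coord_quot_is_linear $$ sect (stalk x) i = 1.
Proof. by apply: val_inj; exact: coord_inv_germ. Qed.

End Coordinate.
End StalkTwist.

Theorem theorem3p3 (R : realType) (r n k : nat) (X : set (coords R r))
    (hX : quasi_projective X) (hirr : irreducible_set X) (hdim : has_dim X n)
    (hn : (1 <= n)%N) (hk : (2 <= k)%N) :
  (forall x : X, locus_U n k.-1 x ->
     (forall G, corresponds G (dgauss (stalk x) k.-1)
        <-> G = fundform (stalk x) k) /\
     (forall delta, corresponds (fundform (stalk x) k) delta
        <-> delta = dgauss (stalk x) k.-1)) /\
  (forall (W : set X) (s : 'I_n -> coords R r -> complex R),
     opens W -> is_affine W -> W `<=` nonsingular n -> W `<=` locus_U n k.-1 ->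
     (forall i (x : X), W x -> regular_at 0 X (val x) (s i)) ->
     (forall x : X, W x -> is_basis (fun i => dif (rgerm x (s i)))) ->
     forall (x : X) (d : Tan (stalk x)), W x ->
       hcomp (dgauss (stalk x) k.-1 $$ d) (alpha_dual (stalk x) k.-1)
       = hcomp (ftwist_at (fundform (stalk x) k) d) (pr_sym (stalk x) k.-1)).
Proof.
(* From here [k] is the former [k.-1]: the form has order [k.+1] and the Gauss map order [k]. *)
case: k hk => // k _.
have loc (x : X) : locus_U n k x ->
    [/\ corresponds (fundform (stalk x) k.+1) (dgauss (stalk x) k),
        forall (G G' : lhom (Rk (stalk x) k)
                         (sympow k.+1 (Omega (stalk x)))) delta,
          corresponds (k := k.+1) G delta ->
          corresponds (k := k.+1) G' delta -> G = G'
      & forall B, exists Y, alpha_dual (stalk x) k $$ Y = B].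
  move=> [U [_ Un Ux Uc]].
  have [i xi] := quasi_projective_neq0 x hX.
  have leE := coord_quotK xi; have lc1 := coord_quot1 xi.
  have [p [g [D gD]]] := exact_dual_basis_exists (Un _ Ux).
  have [c Cc] := Uc k (leqnn k).
  split; first exact: (fundform_corresponds leE lc1 gD (stalk_factorial x)).
    exact: (corresponds_uniq leE lc1 gD (stalk_factorial x)).
  exact: (alpha_dual_surj leE lc1 (Cc _ Ux)).
split=> [x Ux|W s _ _ _ WU _ _ x d Wx].
  have [h huniq hsurj] := loc x Ux; split=> [G|delta]; split=> [|-> //].
    by move=> hG; apply: huniq hG h.
  (* The square fixes [delta] on the image of [alpha_dual], which is everything. *)
  move=> hd; apply: hom_ext => d; apply: hom_ext => B.
  by have [Y <-] := hsurj B; rewrite hd h.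
have [h _ _] := loc x (WU x Wx).
by apply: hom_ext => Y; exact: h.
Qed.
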